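(* Let $d\ge 1$, let $\Omega\subset\mathbb{R}^d$ be a simply connected polygonal or polyhedral domain, let $\mathcal{T}_h$ be an arbitrary simplicial mesh of $\Omega$ with interior vertices numbered $1,\dots,N_{vi}$, and let $\phi_1,\dots,\phi_{N_{vi}}$ be the associated linear finite element basis functions. Let $B=(B_{ij})$ be the mass matrix, $B_{ij}=\int_\Omega \phi_i\phi_j\,d\boldsymbol{x}$ for $i,j=1,\dots,N_{vi}$. Then the condition number of $B$ satisfies $$\frac{\max_j B_{jj}}{\min_j B_{jj}}\;\le\;\kappa(B)\;\le\;(d+2)\,\frac{\max_j B_{jj}}{\min_j B_{jj}},$$ where the maxima and minima are over $j=1,\dots,N_{vi}$.
   Context: A simplicial mesh $\mathcal{T}_h$ of $\Omega$ is a simplicial decomposition (triangulation) of $\overline\Omega$ into finitely many nondegenerate $d$-simplices as used for conforming linear finite elements; no assumption on the shape or size of the elements is made. The mesh is assumed to have at least one interior vertex (a vertex not on $\partial\Omega$); the vertices are ordered so that the first $N_{vi}$ are the interior ones. For each interior vertex $j$, $\phi_j$ is the continuous function on $\overline\Omega$ that is affine on each element, equals $1$ at vertex $j$ and $0$ at all other vertices (including boundary vertices). $\kappa(B)=\lambda_{\max}(B)/\lambda_{\min}(B)$ is the spectral condition number of the symmetric positive definite matrix $B$. *)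

(* Defs.v *)
From HB Require Import structures.
From mathcomp Require Import all_boot all_order all_algebra.
From mathcomp Require Import all_classical all_reals all_analysis.
Import Order.TTheory GRing.Theory Num.Theory.
Import numFieldNormedType.Exports.

Set Implicit Arguments.
Unset Strict Implicit.
Unset Printing Implicit Defensive.

Local Open Scope classical_set_scope.
Local Open Scope ring_scope.

(* Matrices carry the product sigma-algebra, generated by their coordinates. *)
Definition mx_coord d (T : measurableType d) m n : set_system 'M[T]_(m, n) :=
  [set C | exists i j (A : set T),
             measurable A /\ C = (fun M : 'M[T]_(m, n) => M i j) @^-1` A].

Definition mx_display : measure_display -> measure_display.
Proof. exact. Qed.

Section measurable_matrix.
Context d (T : measurableType d) (m n : nat).

Let sigma_mx := <<s @mx_coord d T m n >>.

Let mx_set0 : sigma_mx set0. Proof. exact: sigma_algebra0. Qed.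

Let mx_setC A : sigma_mx A -> sigma_mx (~` A).
Proof. exact: sigma_algebraC. Qed.

Let mx_bigcup (F : (set 'M[T]_(m, n))^nat) :
  (forall i, sigma_mx (F i)) -> sigma_mx (\bigcup_i F i).
Proof. exact: sigma_algebra_bigcup. Qed.

HB.instance Definition _ := @isMeasurable.Build (mx_display d)
  'M[T]_(m, n) sigma_mx mx_set0 mx_setC mx_bigcup.

End measurable_matrix.
(* Lebesgue measure on R^n, as the n-fold product of the one-dimensional one:
   R^(n+1) is identified with R x R^n through consrv. *)
Section lebesgue_measure_rV.
Context {R : realType}.

Definition consrv n (p : measurableTypeR R * 'rV[R]_n) : 'rV[R]_n.+1 :=
  \row_i (if unlift ord0 i is Some j then p.2 0 j else p.1).

Lemma consrv0 n p : @consrv n p 0 ord0 = p.1.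
Proof. by rewrite mxE unlift_none. Qed.

Lemma consrvS n p (j : 'I_n) : @consrv n p 0 (lift ord0 j) = p.2 0 j.
Proof. by rewrite mxE liftK. Qed.

Lemma measurable_mx_coord m n i j :
  measurable_fun [set: 'M[R]_(m, n)] (fun M => M i j).
Proof.
move=> _ A mA; rewrite setTI; apply: sub_sigma_algebra.
by exists i, j, A; split.
Qed.

Lemma measurable_consrv n : measurable_fun setT (@consrv n).
Proof.
apply: (measurability (@mx_coord _ R 1 n.+1)) => // _ [_ [i [j [A [mA ->]]]] <-].
rewrite setTI -comp_preimage -[X in measurable X]setTI.
rewrite (ord1 i); case: (unliftP ord0 j) => [k ->|->].
- rewrite (_ : _ \o _ = (fun M : 'rV[R]_n => M 0 k) \o snd); last first.
    by apply/funext => p /=; rewrite consrvS.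
  exact: (measurableT_comp (@measurable_mx_coord 1 n 0 k)).
- rewrite (_ : _ \o _ = fst); last by apply/funext => p /=; rewrite consrv0.
  exact: measurable_fst.
Qed.


HB.instance Definition _ n :=
  isMeasurableFun.Build _ _ _ _ (@consrv n) (@measurable_consrv n).

Definition headtail n (v : 'rV[R]_n.+1) : measurableTypeR R * 'rV[R]_n :=
  (v 0 ord0, \row_j v 0 (lift ord0 j)).

Lemma consrvK n : cancel (@consrv n) (@headtail n).
Proof.
move=> [x v]; rewrite /headtail consrv0; congr (_, _).
by apply/rowP => j; rewrite mxE consrvS.
Qed.

Lemma measurable_headtail n : measurable_fun setT (@headtail n).
Proof.
apply/measurable_fun_pairP; split; first exact: measurable_mx_coord.
apply: (measurability (@mx_coord _ R 1 n)) => // _ [_ [i [j [A [mA ->]]]] <-].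
rewrite setTI -comp_preimage -[X in measurable X]setTI (ord1 i).
rewrite (_ : _ \o _ = fun v : 'rV[R]_n.+1 => v 0 (lift ord0 j)).
  exact: measurable_mx_coord.
by apply/funext => v /=; rewrite mxE.
Qed.

Section cons_measure.
Variables (n : nat) (mu : {sigma_finite_measure set 'rV[R]_n -> \bar R}).

Definition cons_measure := pushforward (lebesgue_measure \x mu)%E (@consrv n).

Let cons_measure0 : cons_measure set0 = 0%E.
Proof. by rewrite /cons_measure /pushforward preimage_set0 measure0. Qed.

Let cons_measure_ge0 A : (0 <= cons_measure A)%E.
Proof. exact: measure_ge0. Qed.

Let cons_measure_sigma_additive : semi_sigma_additive cons_measure.
Proof.
exact: (@measure_semi_sigma_additive _ _ _
  (pushforward (lebesgue_measure \x mu)%E (@consrv n))).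
Qed.

HB.instance Definition _ := isMeasure.Build _ _ _ cons_measure
  cons_measure0 cons_measure_ge0 cons_measure_sigma_additive.

Let cons_measure_sigma_finite : sigma_finite setT cons_measure.
Proof.
have /sigma_finiteP[F [UF ndF mF]] := sigma_finiteT (@lebesgue_measure R).
have /sigma_finiteP[G [UG ndG mG]] := sigma_finiteT mu.
exists (fun k => @headtail n @^-1` (F k `*` G k)).
  rewrite -preimage_bigcup (_ : \bigcup_k _ = setT) ?preimage_setT//.
  rewrite -subTset => -[x v] _.
  have [k _ Fkx] : (\bigcup_k F k) x by rewrite -UF.
  have [l _ Glv] : (\bigcup_k G k) v by rewrite -UG.
  exists (maxn k l) => //; split => /=.
    by move: x Fkx; exact/subsetPset/ndF/leq_maxl.
  by move: v Glv; exact/subsetPset/ndG/leq_maxr.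
move=> k; have [mFk Fkoo] := mF k; have [mGk Gkoo] := mG k; split.
  rewrite -[X in measurable X]setTI; apply: measurable_headtail => //.
  exact: measurableX.
rewrite /cons_measure /pushforward -comp_preimage.
rewrite (_ : _ \o _ = idfun); last by apply/funext => p /=; rewrite consrvK.
by rewrite preimage_id product_measure1E// lte_mul_pinfty// ge0_fin_numE.
Qed.

HB.instance Definition _ := Measure_isSigmaFinite.Build _ _ _ cons_measure
  cons_measure_sigma_finite.

End cons_measure.

Fixpoint lebesgue_measure_rV n : {sigma_finite_measure set 'rV[R]_n -> \bar R} :=
  match n with
  | 0 => dirac (0 : 'rV[R]_0)
  | m.+1 => cons_measure (lebesgue_measure_rV m)
  end.

Lemma lebesgue_measure_rV_box n (A : 'I_n -> set (measurableTypeR R)) :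
  (forall i, measurable (A i)) ->
  lebesgue_measure_rV n [set v | forall i, A i (v 0 i)] =
  (\prod_(i < n) lebesgue_measure (A i))%E.
Proof.
elim: n A => [|n IH] A mA.
  by rewrite big_ord0 /= diracE mem_set// => -[].
rewrite big_ord_recl -IH//.
have mbox : measurable [set v : 'rV[R]_n | forall i, A (lift ord0 i) (v 0 i)].
  rewrite (_ : mkset _ = \big[setI/setT]_(i < n)
      ((fun v : 'rV[R]_n => v 0 i) @^-1` A (lift ord0 i))).
    apply: bigsetI_measurable => i _; rewrite -[X in measurable X]setTI.
    by apply: measurable_mx_coord => //; exact: mA.
  rewrite -bigcap_seq; apply/seteqP; split => v /= h i; first by move=> _; exact: h.
  by apply: h; rewrite /= mem_index_enum.
rewrite -product_measure1E//=; congr (product_measure1 _ _ _).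
apply/seteqP; split => [[a v] /= h|[a v] /= [h0 h] i].
  by split => [|i]; [have := h ord0; rewrite consrv0
                    |have := h (lift ord0 i); rewrite consrvS].
by case: (unliftP ord0 i) => [j ->|->]; rewrite ?consrvS ?consrv0//; exact: h.
Qed.

End lebesgue_measure_rV.

Section topology.
Context {R : realType} {T : topologicalType}.
Implicit Types A : set T.

Definition boundary A := closure A `\` interior A.

Definition path_in A (g : R -> T) :=
  {within `[0, 1], continuous g} /\ forall t, t \in `[0, 1] -> A (g t).

Definition path_connected A := forall a b, A a -> A b ->
  exists g : R -> T, [/\ path_in A g, g 0 = a & g 1 = b].

Definition null_homotopic A (g : R -> T) := exists H : R * R -> T,
  [/\ {within `[0, 1] `*` `[0, 1], continuous H},
      forall s t, s \in `[0, 1] -> t \in `[0, 1] -> A (H (s, t)),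
      forall t, t \in `[0, 1] -> H (0, t) = g t,
      forall t, t \in `[0, 1] -> H (1, t) = g 0 &
      forall s, s \in `[0, 1] -> H (s, 0) = g 0 /\ H (s, 1) = g 0].

Definition simply_connected A := path_connected A /\
  forall g : R -> T, path_in A g -> g 0 = g 1 -> null_homotopic A g.

End topology.

Section simplicial_mesh.
Context {R : realType} {d : nat}.
Implicit Type Omega : set 'rV[R]_d.

Definition affinely_independent (I : finType) (x : I -> 'rV[R]_d) (K : {set I}) :=
  forall c : I -> R, \sum_(i in K) c i = 0 -> \sum_(i in K) c i *: x i = 0 ->
    forall i, i \in K -> c i = 0.

Definition hull (I : finType) (x : I -> 'rV[R]_d) (K : {set I}) : set 'rV[R]_d :=
  [set y | exists c : I -> R,
     [/\ forall i, i \in K -> 0 <= c i,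
         \sum_(i in K) c i = 1 &
         y = \sum_(i in K) c i *: x i]].

(* The boundary is made of finitely many nondegenerate (d-1)-simplices, the
   convex hulls of d affinely independent points (single points if d = 1). *)
Definition polyhedral_domain Omega :=
  [/\ Omega !=set0, open Omega, connected Omega, bounded_set Omega &
    exists (m : nat) (p : 'I_m -> 'rV[R]_d) (F : {set {set 'I_m}}),
      (forall f, f \in F -> #|f| = d /\ affinely_independent p f) /\
      boundary Omega = \bigcup_(f in [set` F]) hull p f].

(* N vertices x_0, ..., x_(N-1); an element is given by its set of d+1 vertices.
   hull x set0 is empty, so mesh_conforming covers disjoint elements. *)
Record simplicial_mesh Omega N (x : 'I_N -> 'rV[R]_d)
    (Th : {set {set 'I_N}}) : Prop := {
  mesh_vertex_inj : injective x ;
  mesh_vertex_used : forall i, exists2 K, K \in Th & i \in K ;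
  mesh_card : forall K, K \in Th -> #|K| = d.+1 ;
  mesh_nondegenerate : forall K, K \in Th -> affinely_independent x K ;
  mesh_conforming : forall K L, K \in Th -> L \in Th ->
    hull x K `&` hull x L = hull x (K :&: L) ;
  mesh_cover : \bigcup_(K in [set` Th]) hull x K = closure Omega }.

Definition interior_first Omega Nvi Nvb (x : 'I_(Nvi + Nvb) -> 'rV[R]_d) :=
  forall i : 'I_(Nvi + Nvb), (i < Nvi)%N <-> ~ boundary Omega (x i).

Definition affine_on (A : set 'rV[R]_d) (f : 'rV[R]_d -> R) :=
  exists (a : 'cV[R]_d) (b : R), forall y, A y -> f y = (y *m a) 0 0 + b.

Definition hat_function Omega N (x : 'I_N -> 'rV[R]_d) (Th : {set {set 'I_N}})
    (j : 'I_N) (f : 'rV[R]_d -> R) :=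
  [/\ {within closure Omega, continuous f},
      forall K, K \in Th -> affine_on (hull x K) f &
      forall i, f (x i) = (i == j)%:R].

Definition mass_matrix Omega n (phi : 'I_n -> 'rV[R]_d -> R) : 'M[R]_n :=
  \matrix_(i, j) \int[lebesgue_measure_rV d]_(y in Omega) (phi i y * phi j y).

End simplicial_mesh.

(* For a symmetric B of positive size the sets below are finite and nonempty, so
   that sup and inf are a maximum and a minimum. *)
Section condition_number.
Context {R : realType} {n : nat}.
Implicit Type B : 'M[R]_n.

Definition lambda_max B : R := sup [set a | eigenvalue B a].
Definition lambda_min B : R := inf [set a | eigenvalue B a].
Definition condition_number B : R := lambda_max B / lambda_min B.

Definition max_diag B : R := sup (range (fun j => B j j)).
Definition min_diag B : R := inf (range (fun j => B j j)).

End condition_number.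

(* Main.v *)
(** The mass matrix is a sum over the elements [K] of local mass matrices, and
    these are all proportional to [I + J], with [J] the all-ones matrix: for
    barycentric coordinates one has int_K l_i^2 = int_K l_k^2 and
    int_K l_i l_j = 1/2 int_K l_i^2. The eigenvalues of [I + J] lie between [1]
    and [d + 2] while its diagonal is [2], so u B u^T lies between 1/2 and
    (d + 2)/2 times u D u^T, where [D] is the diagonal of [B]. Together with
    lambda_min <= B_jj <= lambda_max this gives both bounds.

    The moments need no explicit integration and no determinants: an affine
    bijection scales all integrals by one common factor. Swapping two vertices
    yields the first identity. Bisecting the edge [ij] at its midpoint writes
    the moment b of l_i l_j as an average, over the two halves, of b/2 + a/4,
    where a is the moment of l_i^2; hence b = a/2. *)

Require Import Defs.
From HB Require Import structures.
From mathcomp Require Import all_boot all_order all_algebra all_fingroup.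
From mathcomp Require Import all_classical all_reals all_analysis.
From mathcomp Require Import measurable_realfun.
From mathcomp Require Import ring lra.
Import Order.TTheory GRing.Theory Num.Theory.
Import numFieldNormedType.Exports.

Local Open Scope classical_set_scope.
Local Open Scope ring_scope.

(** * Measurability of matrix-valued maps *)

Section measurable_rV.
Context {R : realType}.

Lemma measurable_fun_mx d (T : measurableType d) m n (f : T -> 'M[R]_(m, n)) :
  (forall i j, measurable_fun setT (fun t => f t i j)) -> measurable_fun setT f.
Proof.
move=> mf; apply: (measurability (@mx_coord _ R m n)) => //.
move=> _ [_ [i [j [A [mA ->]]]] <-].
rewrite setTI -comp_preimage -[X in measurable X]setTI.
exact: mf.
Qed.

Lemma measurable_mulmxr m n p (A : 'M[R]_(n, p)) :
  measurable_fun [set: 'M[R]_(m, n)] (fun v => v *m A).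
Proof.
apply: measurable_fun_mx => i j.
under eq_fun do rewrite mxE.
apply: measurable_sum => k; apply: measurable_funM => //.
exact: measurable_mx_coord.
Qed.

Lemma measurable_addmx d (T : measurableType d) m n (f g : T -> 'M[R]_(m, n)) :
  measurable_fun setT f -> measurable_fun setT g ->
  measurable_fun setT (fun t => f t + g t).
Proof.
move=> mf mg; apply: measurable_fun_mx => i j.
under eq_fun do rewrite mxE.
by apply: measurable_funD; exact: (measurableT_comp (@measurable_mx_coord R m n i j)).
Qed.

Lemma measurable_oppmx d (T : measurableType d) m n (f : T -> 'M[R]_(m, n)) :
  measurable_fun setT f -> measurable_fun setT (fun t => - f t).
Proof.
move=> mf; apply: measurable_fun_mx => i j.
under eq_fun do rewrite mxE.
by apply: measurable_funN; exact: (measurableT_comp (@measurable_mx_coord R m n i j)).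
Qed.

End measurable_rV.

(** * Translation invariance of Lebesgue measure on [R^n] *)

Section translation.
Context {R : realType}.
Local Open Scope ereal_scope.

Let shiftR (t : R) (x : measurableTypeR R) : measurableTypeR R := (x + t)%R.

Let measurable_shiftR t : measurable_fun setT (shiftR t).
Proof. exact: measurable_funD. Qed.

(** The image measure gives each half-open interval its length, and this determines Lebesgue
    measure. *)
Lemma lebesgue_measure_shift (t : R) (A : set (measurableTypeR R)) :
  measurable A -> pushforward lebesgue_measure (shiftR t) A = lebesgue_measure A.
Proof.
pose F : {mfun measurableTypeR R >-> measurableTypeR R} :=
  HB.pack (shiftR t) (isMeasurableFun.Build _ _ _ _ _ (measurable_shiftR t)).
move=> mA; apply/esym.
apply: (lebesgue_measure_unique (mu := pushforward lebesgue_measure F)) => //=.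
move=> _ [[a b]] _ <-; rewrite /pushforward.
have -> : F @^-1` [set` `]a, b] ] = [set` `](a - t)%R, (b - t)%R] ].
  by apply/seteqP; split=> x /=; rewrite !in_itv/= ltrBlDr lerBrDr.
by rewrite !lebesgue_measure_itv/= !lte_fin ltrD2r -!EFinB opprB addrA subrK.
Qed.

Lemma ge0_integral_shift (t : R) (f : measurableTypeR R -> \bar R) :
  measurable_fun setT f -> (forall x, 0 <= f x) ->
  \int[lebesgue_measure]_x f (x + t)%R = \int[lebesgue_measure]_x f x.
Proof.
move=> mf f0.
rewrite -[LHS]/(\int[_]_(x in shiftR t @^-1` setT) (f \o shiftR t) x).
rewrite -ge0_integral_pushforward//.
apply: eq_measure_integral => A mA _.
exact: lebesgue_measure_shift.
Qed.

(** Tonelli's theorem for the recursive construction of the measure; it allows induction on the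
    dimension. *)
Lemma integral_rVS n (f : 'rV[R]_n.+1 -> \bar R) :
  measurable_fun setT f -> (forall x, 0 <= f x) ->
  \int[lebesgue_measure_rV n.+1]_x f x =
  \int[lebesgue_measure]_a \int[lebesgue_measure_rV n]_v f (consrv (a, v)).
Proof.
move=> mf f0 /=.
transitivity (\int[lebesgue_measure \x lebesgue_measure_rV n]_p f (consrv p)).
  rewrite -[RHS]/(\int[_]_(x in @consrv R n @^-1` setT) (f \o @consrv R n) x).
  rewrite -ge0_integral_pushforward//; exact: measurable_consrv.
rewrite fubini_tonelli1//.
by apply: measurableT_comp => //; exact: measurable_consrv.
Qed.

(** By induction on [n]: the tail is shifted in the inner integral, then the head by the
    one-dimensional case. *)
Lemma ge0_integral_rV_shift n (t : 'rV[R]_n) (f : 'rV[R]_n -> \bar R) :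
  measurable_fun setT f -> (forall x, 0 <= f x) ->
  \int[lebesgue_measure_rV n]_x f (x + t)%R = \int[lebesgue_measure_rV n]_x f x.
Proof.
elim: n t f => [|n IH] t f mf f0.
  by apply: eq_integral => x _; rewrite [t]thinmx0 addr0.
rewrite [LHS]integral_rVS//; last first.
  apply: (measurableT_comp mf).
  exact: measurable_addmx.
rewrite [RHS]integral_rVS//.
have cE a v :
    (consrv (a, v) + t = consrv (a + t 0 ord0, v + \row_j t 0 (lift ord0 j)))%R.
  apply/rowP => i; rewrite [LHS]mxE.
  by case: (unliftP ord0 i) => [j ->|->]; rewrite ?consrvS ?consrv0//= !mxE.
have mc : measurable_fun setT (fun p => f (@consrv R n p)).
  by apply: measurableT_comp => //; exact: measurable_consrv.
transitivity (\int[lebesgue_measure]_a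
    (fun a => \int[lebesgue_measure_rV n]_v f (consrv (a, v))) (a + t 0 ord0)%R).
  apply: eq_integral => a _ /=; under eq_integral do rewrite cE.
  apply: (IH _ (fun v => f (consrv ((a + t 0 ord0)%R, v)))) => //.
  apply: (measurableT_comp mc); exact: measurable_pair1.
apply: (ge0_integral_shift _
  (fun a => \int[lebesgue_measure_rV n]_v f (consrv (a, v)))).
  exact: (measurable_fun_fubini_tonelli_F (fun p => f (consrv p))).
by move=> a; apply: integral_ge0.
Qed.

End translation.

(** * Affine change of variables, and null hyperplanes *)

Section affine_change_of_variables.
Context {R : realType} {n : nat}.
Local Open Scope ereal_scope.
Let mu := @lebesgue_measure_rV R n.

Lemma measurable_fun_indicE d (T : measurableType d) (S : set T) :
  measurable S -> measurable_fun setT (fun x => (\1_S x)%:E : \bar R).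
Proof. by move=> mS; apply/measurable_EFinP; exact: measurable_indic. Qed.

Lemma measurable_affine (A : 'M[R]_n) (b : 'rV[R]_n) :
  measurable_fun setT (fun x : 'rV[R]_n => (x *m A + b)%R).
Proof.
by apply: measurable_addmx; [exact: measurable_mulmxr|exact: measurable_cst].
Qed.

(* With [T x = x *m A + b], integrate [1_S (T x) g y] over both variables and
   substitute [y -> y + T x], then [x -> x - y *m A^-1]: only translations of
   Lebesgue measure are used, as in the proof of uniqueness of Haar measure. *)
Lemma affine_preimage_integralN (A : 'M[R]_n) (b : 'rV[R]_n)
    (S : set 'rV[R]_n) (g : 'rV[R]_n -> \bar R) :
  A \in unitmx -> measurable S -> measurable_fun setT g -> (forall x, 0 <= g x) ->
  mu ((fun x => x *m A + b)%R @^-1` S) * \int[mu]_x g x =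
  mu (-%R @^-1` S) * \int[mu]_x g (x *m A + b)%R.
Proof.
move=> uA mS mg g0; set T := fun x : 'rV[R]_n => (x *m A + b)%R.
have mT : measurable_fun setT T by exact: measurable_affine.
have mT1 : measurable_fun setT (fun p : 'rV[R]_n * 'rV[R]_n => T p.1).
  exact: (measurableT_comp mT).
have mI : measurable_fun setT (fun x => (\1_S x)%:E : \bar R).
  exact: measurable_fun_indicE.
have I0 x : 0 <= (\1_S x)%:E :> \bar R by rewrite lee_fin.
have shiftE := ge0_integral_rV_shift.
have mN : measurable_fun setT (-%R : 'rV[R]_n -> 'rV[R]_n).
  exact: measurable_oppmx.
have mpre f : measurable_fun setT f -> measurable (f @^-1` S : set 'rV[R]_n).
  by move=> mf; rewrite -[X in measurable X]setTI; exact: mf.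
have indE f : measurable_fun setT f ->
    \int[mu]_x (\1_S (f x : 'rV[R]_n))%:E = mu (f @^-1` S).
  move=> mf; rewrite -[LHS]/(\int[_]_x (\1_(f @^-1` S) x)%:E).
  by rewrite integral_indic ?setIT//; exact: mpre.
have mshift a (f : 'rV[R]_n -> \bar R) : measurable_fun setT f ->
    measurable_fun setT (fun y : 'rV[R]_n => f (y + a)%R).
  by move=> mf; apply: (measurableT_comp mf); exact: measurable_addmx.
have mT2 : measurable_fun setT (fun p : 'rV[R]_n * 'rV[R]_n => (p.2 + T p.1)%R).
  exact: measurable_addmx.
have mT3 : measurable_fun setT (fun p : 'rV[R]_n * 'rV[R]_n => (T p.1 - p.2)%R).
  by apply: measurable_addmx => //; exact: measurable_oppmx.
transitivity (\int[mu]_x \int[mu]_y ((\1_S (T x))%:E * g (y + T x)%R)).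
  rewrite -indE// -ge0_integralZr//; last 2 first.
  - exact: (measurableT_comp mI).
  - exact: integral_ge0.
  apply: eq_integral => x _; rewrite ge0_integralZl//; last exact: mshift.
  by congr (_ * _); rewrite shiftE.
rewrite (fubini_tonelli (fun p : 'rV[R]_n * 'rV[R]_n =>
    (\1_S (T p.1))%:E * g (p.2 + T p.1)%R))/=; last 2 first.
- apply: emeasurable_funM; first exact: (measurableT_comp mI).
  exact: (measurableT_comp mg).
- by move=> p; rewrite mule_ge0.
transitivity (\int[mu]_y \int[mu]_x ((\1_S (T x - y)%R)%:E * g (T x))).
  apply: eq_integral => y _.
  rewrite -(shiftE _ _ (- (y *m invmx A))%R)//; last 2 first.
  - apply: emeasurable_funM; first exact: (measurableT_comp mI).
    by apply: (measurableT_comp mg); exact: measurable_addmx.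
  - by move=> x; rewrite mule_ge0.
  apply: eq_integral => x _.
  have -> : T (x - y *m invmx A)%R = (T x - y)%R.
    by rewrite /T mulmxDl mulNmx -mulmxA mulVmx// mulmx1 addrAC.
  by rewrite (addrC y) subrK.
rewrite -(fubini_tonelli (fun p : 'rV[R]_n * 'rV[R]_n =>
    (\1_S (T p.1 - p.2)%R)%:E * g (T p.1)))/=; last 2 first.
- apply: emeasurable_funM; first exact: (measurableT_comp mI).
  exact: (measurableT_comp mg).
- by move=> p; rewrite mule_ge0.
rewrite muleC -indE// -ge0_integralZr//; last 2 first.
- exact: (measurableT_comp mg).
- exact: integral_ge0.
apply: eq_integral => x _.
rewrite muleC.
under eq_integral do rewrite muleC.
have mTx : measurable_fun setT (fun y : 'rV[R]_n => (\1_S (T x - y)%R)%:E : \bar R).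
  apply: (measurableT_comp mI); apply: measurable_addmx; first exact: measurable_cst.
  exact: measurable_oppmx.
rewrite ge0_integralZl//; last first.
rewrite muleC; congr (_ * _).
(* The shift by [T x] turns [T x - y] into [- y], hence the reflected set in the statement. *)
rewrite -(shiftE _ _ (T x)) //.
by apply: eq_integral => y _; rewrite opprD addrC subrK.
Qed.

Lemma box_measurable (a b : R) :
  measurable [set v : 'rV[R]_n | forall i, v 0%R i \in `[a, b]].
Proof.
rewrite (_ : mkset _ = \big[setI/setT]_(i < n)
    ((fun v : 'rV[R]_n => v 0%R i) @^-1` `[a, b])).
  apply: bigsetI_measurable => i _; rewrite -[X in measurable X]setTI.
  by apply: measurable_mx_coord.
rewrite -bigcap_seq; apply/seteqP; split => v /= h i; first by move=> _; exact: h.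
by apply: h; rewrite /= mem_index_enum.
Qed.

Lemma box_measure (a b : R) : (a <= b)%R ->
  mu [set v : 'rV[R]_n | forall i, v 0%R i \in `[a, b]] = ((b - a) ^+ n)%:E.
Proof.
move=> ab; have := @lebesgue_measure_rV_box R n (fun=> `[a, b]%classic).
rewrite -/mu => -> //; under eq_bigr do rewrite lebesgue_measure_itv/=.
have -> : (if a%:E < b%:E then b%:E - a%:E else 0) = (b - a)%:E.
  by rewrite lte_fin; case: ltgtP ab => // [-> _]; rewrite subrr.
by rewrite prodEFin prodr_const card_ord.
Qed.

(** The previous identity for the identity map, with [g] the indicator of the unit cube, whose
    integral is 1. *)
Lemma measure_opp (S : set 'rV[R]_n) : measurable S -> mu (-%R @^-1` S) = mu S.
Proof.
move=> mS; pose Q := [set v : 'rV[R]_n | forall i, v 0%R i \in `[0%R, 1%R]].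
have := @affine_preimage_integralN 1%:M 0%R S (fun x => (\1_Q x)%:E) (unitmx1 _ _) mS.
under [X in _ -> _ -> _ = _ * X]eq_integral do rewrite mulmx1 addr0.
have intQ : \int[mu]_x (\1_Q x)%:E = 1.
  rewrite integral_indic//; last exact: box_measurable.
  by rewrite setIT [LHS]box_measure// subr0 expr1n.
rewrite intQ !mule1 => <- //.
- congr (mu _); apply/seteqP; by split=> x/=; rewrite mulmx1 addr0.
- by apply: measurable_fun_indicE; exact: box_measurable.
Qed.

(** Since [S] and [g] vary independently, an affine bijection scales all measures and integrals by
    one common factor. *)
Lemma affine_preimage_integral (A : 'M[R]_n) (b : 'rV[R]_n)
    (S : set 'rV[R]_n) (g : 'rV[R]_n -> \bar R) :
  A \in unitmx -> measurable S -> measurable_fun setT g -> (forall x, 0 <= g x) ->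
  mu ((fun x => x *m A + b)%R @^-1` S) * \int[mu]_x g x =
  mu S * \int[mu]_x g (x *m A + b)%R.
Proof. by move=> uA mS mg g0; rewrite affine_preimage_integralN// measure_opp. Qed.

End affine_change_of_variables.


(** The vector [a] is completed to an invertible matrix with first row [a^T]. The hyperplane is then
    the preimage of a coordinate hyperplane under a linear bijection, and the latter is a box with
    one degenerate side. *)
Lemma hyperplane_null {R : realType} n (a : 'cV[R]_n) (b : R) : a != 0 ->
  lebesgue_measure_rV n [set y | (y *m a) 0 0 = b] = 0%E.
Proof.
case: n a => [|n] a a0; first by rewrite flatmx0 eqxx in a0.
pose e : 'rV[R]_n.+1 := delta_mx 0 ord0.
pose f : 'M[R]_n.+1 := \matrix_(i, j) (a j 0 *+ (i == 0)).
have ef : e *m f = a^T by rewrite -rowE; apply/rowP => j; rewrite !mxE eqxx.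
have [|g gu eg] := @complete_unitmx _ _ _ e f.
  rewrite ef mxrank_tr mxrank_delta; apply/eqP.
  by rewrite eqn_leq rank_leq_col lt0n mxrank_eq0.
pose S := [set z : 'rV[R]_n.+1 | z 0 ord0 = b].
have mS : measurable S.
  rewrite -[X in measurable X]setTI.
  by apply: (@measurable_mx_coord R 1 n.+1 0 ord0 measurableT [set b]).
have S0 : lebesgue_measure_rV n.+1 S = 0%E.
  pose A (i : 'I_n.+1) := if i == ord0 then [set b] else [set: R].
  have -> : S = [set v | forall i, A i (v 0 i)].
    apply/seteqP; split=> [z /= zb i|z /(_ ord0)]; last by rewrite /A eqxx.
    by rewrite /A; case: eqP => [->|].
  rewrite lebesgue_measure_rV_box; last first.
    by move=> i; rewrite /A; case: eqP.
  (* The other sides have infinite length, but a zero factor makes the extended product zero. *)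
  by rewrite big_ord_recl {1}/A eqxx lebesgue_measure_set1 mul0e.
pose Q := [set v : 'rV[R]_n.+1 | forall i, v 0%R i \in `[0%R, 1%R]].
have intQ : (\int[lebesgue_measure_rV n.+1]_x (\1_Q x)%:E = 1)%E.
  rewrite integral_indic//; last exact: box_measurable.
  by rewrite setIT [LHS]box_measure// subr0 expr1n.
have mQ : measurable_fun setT (fun x => (\1_Q x)%:E : \bar R).
  by apply: measurable_fun_indicE; exact: box_measurable.
have := @affine_preimage_integral R n.+1 g^T 0 S (fun x => (\1_Q x)%:E) _ mS mQ.
rewrite unitmx_tr intQ mule1 S0 mul0e => <- //.
congr (lebesgue_measure_rV _ _); apply/seteqP.
have yE (y : 'rV[R]_n.+1) : (y *m g^T + 0) 0 ord0 = (y *m a) 0 0.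
  have gE : row ord0 g = a^T by rewrite -ef eg -rowE.
  rewrite addr0 [LHS]mxE [RHS]mxE; apply: eq_bigr => k _; congr (_ * _).
  by have /rowP/(_ k) := gE; rewrite !mxE.
by split=> y; rewrite /S /preimage/= yE.
Qed.

(** * Additivity of the integral over two sets with null overlap *)

Section integral_setU_null.
Context d (T : measurableType d) (R : realType) (mu : {measure set T -> \bar R}).
Local Open Scope ereal_scope.

Lemma ge0_integral_setU_null (A B : set T) (f : T -> \bar R) :
  measurable A -> measurable B -> measurable_fun (A `|` B) f ->
  (forall x, (A `|` B) x -> 0 <= f x) -> mu (A `&` B) = 0 ->
  \int[mu]_(x in A `|` B) f x = \int[mu]_(x in A) f x + \int[mu]_(x in B) f x.
Proof.
move=> mA mB mf f0 AB0.
have mBA : measurable (B `\` A) by exact: measurableD.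
have AUE : A `|` B = A `|` (B `\` A).
  apply/seteqP; split => x.
    by move=> [|Bx]; [left|have [Ax|nAx] := pselect (A x); [left|right]].
  by move=> [|[]]; [left|right].
rewrite {1}AUE ge0_integral_setU//; last 3 first.
- by rewrite -AUE.
- by rewrite -AUE.
- by rewrite disj_set2E; apply/eqP/seteqP; split => // x [Ax []].
congr (_ + _).
have -> : B `\` A = B `\` (A `&` B).
  apply/seteqP; split => x [Bx h]; split => //; first by move=> [].
  by move=> Ax; exact: h.
rewrite -ge0_negligible_integral//.
- exact: measurableI.
- by apply: measurable_funS mf; [exact: measurableU|exact: subsetUr].
- by move=> x Bx; apply: f0; right.
Qed.

End integral_setU_null.

(** * Simplices in barycentric coordinates *)

Section simplex.
Context {R : realType} {d : nat}.
Implicit Types V W : 'M[R]_(1 + d).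
Let mu := @lebesgue_measure_rV R d.

(* In the coordinates [(1, y)] affine maps are linear. *)
Definition homog (y : 'rV[R]_d) : 'rV[R]_(1 + d) := row_mx 1%:M y.

(* The rows of [V] are [homog] of d + 1 affinely independent points. *)
Definition frame V := V \in unitmx /\ lsubmx V = const_mx 1.

(** For a frame [V], these are the barycentric coordinates of [y]: the equation [a *m V = homog y]
    says in its first column that the entries of [a] sum to 1, in the others that they combine the
    vertices to [y]. *)
Definition bary V (y : 'rV[R]_d) : 'rV[R]_(1 + d) := homog y *m invmx V.

Definition simplex V : set 'rV[R]_d := [set y | forall i, 0 <= bary V y 0 i].

Lemma homog0 y : homog y 0 (lshift d 0) = 1.
Proof. by rewrite row_mxEl mxE. Qed.

Lemma measurable_homog : measurable_fun setT homog.
Proof.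
apply: measurable_fun_mx => i j; rewrite (ord1 i).
case: (split_ordP j) => k ->.
  by under eq_fun do rewrite row_mxEl mxE; exact: measurable_cst.
by under eq_fun do rewrite row_mxEr; exact: measurable_mx_coord.
Qed.

Lemma measurable_bary V : measurable_fun setT (bary V).
Proof. exact: (measurableT_comp (measurable_mulmxr _ _ _ _) measurable_homog). Qed.

Lemma baryK V y : V \in unitmx -> bary V y *m V = homog y.
Proof. by move=> uV; rewrite /bary mulmxKV. Qed.

Lemma bary_unique V y a : V \in unitmx -> a *m V = homog y -> bary V y = a.
Proof. by move=> uV aV; rewrite /bary -aV mulmxK. Qed.

Lemma bary_sum1 V y : frame V -> \sum_i bary V y 0 i = 1.
Proof.
move=> [uV V1]; rewrite -(homog0 y) -(baryK V y uV) mxE.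
apply: eq_bigr => i _; have /matrixP/(_ i 0) := V1.
by rewrite !mxE => ->; rewrite mulr1.
Qed.

Lemma bary_le1 V y i : frame V -> simplex V y -> bary V y 0 i <= 1.
Proof.
move=> fV Vy; rewrite -(bary_sum1 V y fV) (bigD1 i)//= lerDl.
by apply: sumr_ge0 => j _; exact: Vy.
Qed.

Lemma measurable_nonneg_set m (f : 'rV[R]_d -> 'rV[R]_m) :
  measurable_fun setT f -> measurable [set y | forall i, 0 <= f y 0 i].
Proof.
move=> mf; rewrite (_ : mkset _ = \big[setI/setT]_(i < m)
    ((fun y => f y 0 i) @^-1` `[0, +oo[)).
  apply: bigsetI_measurable => i _; rewrite -[X in measurable X]setTI.
  by apply: (measurableT_comp (@measurable_mx_coord R 1 m 0 i) mf).
rewrite -bigcap_seq; apply/seteqP; split => v /= h i.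
  by move=> _ /=; rewrite in_itv/= andbT; exact: h.
by have := h i (mem_index_enum i); rewrite /= in_itv/= andbT.
Qed.

Lemma measurable_simplex V : measurable (simplex V).
Proof. by apply: measurable_nonneg_set; exact: measurable_bary. Qed.

(** Barycentric coordinates on the simplex lie in [[0, 1]], so the simplex fits into the cube with
    bounds [- M] and [M], where [M] sums the absolute entries of [V]. *)
Lemma simplex_finite_measure V : frame V -> (mu (simplex V) < +oo)%E.
Proof.
move=> fV; have uV := fV.1.
pose M := \sum_i \sum_k `|V i k|.
have M0 : 0 <= M by apply: sumr_ge0 => i _; exact: sumr_ge0.
have NMM : - M <= M by rewrite (le_trans _ M0)// oppr_le0.
apply: (@le_lt_trans _ _ (mu [set v : 'rV[R]_d | forall i, v 0 i \in `[- M, M]])).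
  apply: le_measure; rewrite ?inE; [exact: measurable_simplex|exact: box_measurable|].
  move=> y Vy k /=; rewrite in_itv/= -ler_norml.
  have -> : y 0 k = (bary V y *m V) 0 (rshift 1 k) by rewrite baryK// row_mxEr.
  rewrite mxE (le_trans (ler_norm_sum _ _ _))//; apply: ler_sum => i _.
  rewrite normrM (@le_trans _ _ `|V i (rshift 1 k)|)//.
    by rewrite ler_piMl// ger0_norm ?bary_le1//; exact: Vy.
  by rewrite (bigD1 (rshift 1 k))//= lerDl sumr_ge0.
by rewrite [X in (X < _)%E]box_measure// ltry.
Qed.

(** If the linear part of [c] vanishes, the constant part does not and the set is empty; otherwise
    the set is a hyperplane. *)
Lemma homog_hyperplane_null (c : 'cV[R]_(1 + d)) : c != 0 ->
  mu [set y | (homog y *m c) 0 0 = 0] = 0%E.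
Proof.
move=> c0.
have hE y : (homog y *m c) 0 0 = c (lshift d 0) 0 + (y *m dsubmx c) 0 0.
  by rewrite -{1}[c]vsubmxK mul_row_col mul1mx !mxE.
have [c20|c20] := eqVneq (dsubmx c) 0.
  rewrite (_ : mkset _ = set0) ?measure0//; apply/seteqP; split => // y /=.
  rewrite hE c20 mulmx0 mxE addr0 => c10; move/eqP: c0; apply.
  rewrite -[c]vsubmxK c20; apply/matrixP => i j; rewrite !mxE.
  by case: splitP => k; rewrite !mxE// !ord1 => _.
rewrite -(hyperplane_null _ _ (- c (lshift d 0) 0) c20).
congr (mu _); apply/seteqP; split=> y /=; rewrite hE.
  by rewrite addrC => /eqP; rewrite addr_eq0 => /eqP.
by move=> ->; rewrite subrr.
Qed.

Lemma measurable_homog_hyperplane (c : 'cV[R]_(1 + d)) :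
  measurable [set y | (homog y *m c) 0 0 = 0].
Proof.
rewrite -[X in measurable X]setTI.
have := measurableT_comp (@measurable_mx_coord R 1 1 0 0)
  (measurableT_comp (measurable_mulmxr 1 _ _ c) measurable_homog).
by move=> /(_ measurableT [set 0]); exact.
Qed.

(** Both frames have first column 1, so the first column of [G] is that of the identity. Hence [G]
    acts on [(1, y)] as an affine map of [y], the one that carries the rows of [V] to those of [W];
    being block triangular, it is invertible together with its linear part. *)
Lemma homog_affine V W y : frame V -> frame W ->
  let G := invmx V *m W in
  homog (y *m drsubmx G + ursubmx G) = homog y *m G /\ drsubmx G \in unitmx.
Proof.
move=> [uV V1] [uW W1] G.
have G1 : lsubmx G = lsubmx 1%:M by rewrite -mulmx_lsub W1 -V1 mulmx_lsub mulVmx.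
split.
  rewrite -[in RHS](hsubmxK G) mul_mx_row; congr row_mx.
    by rewrite G1 mulmx_lsub mulmx1 row_mxKl.
  rewrite -[in RHS](vsubmxK (rsubmx G)) mul_row_col mul1mx [RHS]addrC.
  by congr (_ *m _ + _); apply/matrixP => i j; rewrite !mxE.
have: G \in unitmx by rewrite unitmx_mul unitmx_inv uV.
have GE : G = block_mx 1%:M (ursubmx G) 0 (drsubmx G).
  rewrite -[LHS]submxK; congr block_mx; apply/matrixP => i j.
    by have /matrixP/(_ (lshift d i) j) := G1; rewrite !mxE.
  by have /matrixP/(_ (rshift 1 i) j) := G1; rewrite !mxE eq_rlshift.
by rewrite {1}GE !unitmxE det_ublock det1 mul1r.
Qed.

Local Open Scope ereal_scope.

(** The affine map from frame [V] to frame [W] preserves barycentric coordinates, so the mean of a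
    function of these coordinates is the same on both simplices. Cross-multiplication avoids
    dividing by the volumes. *)
Lemma simplex_integral_affine V W (f : 'rV[R]_(1 + d) -> \bar R) :
  frame V -> frame W -> measurable_fun setT f ->
  (forall a : 'rV_(1 + d), (forall i, 0 <= a 0 i)%R -> 0 <= f a) ->
  mu (simplex V) * \int[mu]_(y in simplex W) f (bary W y) =
  mu (simplex W) * \int[mu]_(y in simplex V) f (bary V y).
Proof.
move=> fV fW mf f0; have mW := measurable_simplex W.
pose G := invmx V *m W; pose T y := (y *m drsubmx G + ursubmx G)%R.
have uA : drsubmx G \in unitmx by have [] := homog_affine V W 0%R fV fW.
have TE y : bary W (T y) = bary V y.
  have [TG _] := homog_affine V W y fV fW.
  by apply: bary_unique; [exact: fW.1|rewrite TG mulmxA].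
rewrite integral_mkcond [in RHS]integral_mkcond.
have SE : T @^-1` simplex W = simplex V.
  by apply/seteqP; split => y Vy i; have := Vy i; rewrite TE.
rewrite -{1}SE (affine_preimage_integral (drsubmx G) (ursubmx G))//; last 2 first.
- apply/(measurable_restrictT _ _).1 => //.
  by apply: measurable_funTS; apply: (measurableT_comp mf); exact: measurable_bary.
- by move=> y; apply: erestrict_ge0 => z; exact: f0.
congr (_ * _); apply: eq_integral => y _; rewrite !patchE.
have -> : (T y \in simplex W) = (y \in simplex V).
  by rewrite -SE; apply/idP/idP; rewrite !inE.
by case: ifP => // _; rewrite TE.
Qed.

End simplex.

(** * Second moments of the barycentric coordinates *)

Section simplex_moments.
Context {R : realType} {d : nat}.
Implicit Types V W : 'M[R]_(1 + d).
Let mu := @lebesgue_measure_rV R d.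
Local Open Scope ereal_scope.

Definition moment V i j : \bar R :=
  \int[mu]_(y in simplex V) (bary V y 0%R i * bary V y 0%R j)%:E.

Lemma measurable_bary_coord V i : measurable_fun setT (fun y => bary V y 0%R i).
Proof.
exact: (measurableT_comp (@measurable_mx_coord R 1 _ 0%R i) (measurable_bary V)).
Qed.

Lemma moment_ge0 V i j : 0 <= moment V i j.
Proof. by apply: integral_ge0 => y Vy; rewrite lee_fin mulr_ge0. Qed.

Lemma moment_le V i j : frame V -> moment V i j <= mu (simplex V).
Proof.
move=> fV; rewrite -[leRHS]mul1e -integral_cst; last exact: measurable_simplex.
apply: ge0_le_integral => //.
- exact: measurable_simplex.
- by move=> y Vy; rewrite lee_fin mulr_ge0.
- apply: measurable_funTS; apply/measurable_EFinP.
  by apply: measurable_funM; exact: measurable_bary_coord.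
- by move=> y Vy; rewrite lee_fin mulr_ile1// bary_le1.
Qed.

(** This settles volume 0, where the volume cannot be cancelled from an identity. *)
Lemma moment_null V i j : frame V -> mu (simplex V) = 0 -> moment V i j = 0.
Proof.
by move=> fV V0; apply/eqP; rewrite eq_le moment_ge0 -V0 moment_le.
Qed.

Lemma mule_fin_inj (r a b : \bar R) : r != 0 -> r \is a fin_num ->
  a \is a fin_num -> b \is a fin_num -> r * a = r * b -> a = b.
Proof.
by case: r a b => [r| |] [a| |] [b| |]// r0 _ _ _; rewrite -!EFinM => -[/(mulfI r0)->].
Qed.

Lemma moment_fin_num V i j : frame V -> moment V i j \is a fin_num.
Proof.
move=> fV; rewrite ge0_fin_numE ?moment_ge0//.
exact: le_lt_trans (moment_le V i j fV) (simplex_finite_measure V fV).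
Qed.

Lemma frame_mull (E : 'M[R]_(1 + d)) V : E \in unitmx ->
  (E *m const_mx 1 = const_mx 1 :> 'cV_(1 + d))%R -> frame V -> frame (E *m V).
Proof.
by move=> uE E1 [uV V1]; split; rewrite ?unitmx_mul ?uE// -mulmx_lsub V1.
Qed.

(** Swapping rows [i] and [j] of [V] keeps the simplex and swaps the two barycentric coordinates. *)
Lemma moment_diag_eq V i j : frame V -> moment V i i = moment V j j.
Proof.
move=> fV; pose W := xrow i j V.
have fW : frame W.
  rewrite /W xrowE; apply: frame_mull => //; first exact: unitmx_perm.
  by rewrite -xrowE; apply/matrixP => k l; rewrite !mxE.
have bW y k : bary W y 0%R k = bary V y 0%R (tperm i j k).
  have -> : bary W y = xcol i j (bary V y); last by rewrite !mxE.
  apply: bary_unique; first exact: fW.1.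
  rewrite /W xcolE xrowE mulmxA -(mulmxA (bary V y)) -perm_mxM tperm2 perm_mx1.
  by rewrite mulmx1 baryK//; exact: fV.1.
have SW : simplex W = simplex V.
  apply/seteqP; split => y Vy k; last by rewrite bW.
  by rewrite -(tpermK i j k) -bW.
have [V0|V0] := eqVneq (mu (simplex V)) 0; first by rewrite !moment_null.
have Vfin : mu (simplex V) \is a fin_num.
  by rewrite ge0_fin_numE//; exact: simplex_finite_measure.
have mf : measurable_fun setT (fun a : 'rV[R]_(1 + d) => (a 0%R i * a 0%R i)%:E).
  apply/measurable_EFinP.
  by apply: measurable_funM; exact: (@measurable_mx_coord R 1 _ 0%R i).
apply: (mule_fin_inj _ _ _ V0); rewrite ?moment_fin_num//.
have := simplex_integral_affine V W _ fV fW mf.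
rewrite SW => <-; last by move=> a a0; rewrite lee_fin mulr_ge0.
by congr (_ * _); apply: eq_integral => y _; rewrite bW tpermL.
Qed.

(* Replaces the [j]-th vertex by the midpoint of vertices [i] and [j]. *)
Definition bisection i j : 'M[R]_(1 + d) :=
  (1%:M - 2^-1 *: (delta_mx j j - delta_mx j i))%R.

(** Since [D] is idempotent, [(1 + D) (1 - t D) = 1 + (1 - 2 t) D], which is 1 for [t = 1 / 2]. *)
Lemma bisectionK i j : i != j ->
  ((1%:M + (delta_mx j j - delta_mx j i)) *m bisection i j = 1%:M)%R.
Proof.
move=> ij; rewrite /bisection; set D := (delta_mx j j - delta_mx j i)%R.
have DD : (D *m D = D)%R.
  rewrite /D mulmxBl !mulmxBr !mul_delta_mx_cond eqxx (negbTE ij).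
  by rewrite !mulr0n subrr subr0.
rewrite mulmxDl !mul1mx mulmxBr mulmx1 -scalemxAr DD -addrA -[RHS]addr0.
congr (_ + _)%R; rewrite addrC -addrA -opprD -scalerDl.
have -> : (2^-1 + 2^-1 = 1 :> R)%R by rewrite -div1r -splitr.
by rewrite scale1r subrr.
Qed.

Lemma bisection_unit i j : i != j -> bisection i j \in unitmx.
Proof. by move=> /bisectionK /mulmx1_unit[]. Qed.

Lemma frame_bisection i j V : i != j -> frame V -> frame (bisection i j *m V).
Proof.
move=> ij; apply: frame_mull; first exact: bisection_unit.
have delta1 k : (delta_mx j k *m const_mx 1 = \col_l (l == j)%:R :> 'cV[R]_(1 + d))%R.
  apply/matrixP => l m; rewrite !mxE (bigD1 k)//= big1 ?addr0.
    by rewrite !mxE eqxx andbT mulr1.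
  by move=> n /negbTE nk; rewrite !mxE nk andbF mul0r.
by rewrite /bisection mulmxBl mul1mx -scalemxAl mulmxBl !delta1 subrr scaler0 subr0.
Qed.

(** The inverse [1 + D] doubles coordinate [j] and subtracts the old coordinate [j] from coordinate
    [i]. *)
Lemma bary_bisection i j V y k : i != j -> frame V ->
  (bary (bisection i j *m V) y 0 k =
   bary V y 0 k + bary V y 0 j * (k == j)%:R - bary V y 0 j * (k == i)%:R)%R.
Proof.
move=> ij fV.
rewrite (bary_unique _ _
  (bary V y *m (1%:M + (delta_mx j j - delta_mx j i)))%R); last 2 first.
- by have [] := frame_bisection i j V ij fV.
- by rewrite mulmxA -(mulmxA (bary V y)) bisectionK// mulmx1 baryK//; exact: fV.1.
rewrite mulmxDr mulmx1 mulmxBr -addrA !mxE; congr (_ + (_ - _))%R.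
- rewrite (bigD1 j)//= big1 ?addr0; first by rewrite !mxE eqxx.
  by move=> l /negbTE lj; rewrite !mxE lj mulr0.
- rewrite (bigD1 j)//= big1 ?addr0; first by rewrite !mxE eqxx.
  by move=> l /negbTE lj; rewrite !mxE lj mulr0.
Qed.

Lemma simplex_bisection i j V : i != j -> frame V ->
  simplex (bisection i j *m V) =
  simplex V `&` [set y | (bary V y 0 j <= bary V y 0 i)%R].
Proof.
move=> ij fV; apply/seteqP; split => y.
  move=> Wy.
  have yj : (0 <= bary V y 0 j)%R.
    have := Wy j; rewrite bary_bisection// eqxx eq_sym (negbTE ij) mulr1 mulr0 subr0.
    by rewrite -mulr2n pmulrn_lge0.
  have yi : (bary V y 0 j <= bary V y 0 i)%R.
    have := Wy i; rewrite bary_bisection// eqxx (negbTE ij) mulr1 mulr0 addr0.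
    by rewrite subr_ge0.
  split => // k; have [->//|kj] := eqVneq k j.
  have [->|ki] := eqVneq k i; first exact: le_trans yi.
  have := Wy k; rewrite bary_bisection// (negbTE ki) (negbTE kj).
  by rewrite !mulr0 addr0 subr0.
move=> [Vy /= yij] k; rewrite bary_bisection//.
have [->|kj] := eqVneq k j.
  by rewrite eq_sym (negbTE ij) mulr1 mulr0 subr0 addr_ge0.
have [->|ki] := eqVneq k i; rewrite mulr0 addr0.
  by rewrite mulr1 subr_ge0.
by rewrite subr0.
Qed.

(** In the coordinates [w] of the half, coordinates [j] and [i] of [V] are [w_j / 2] and
    [w_i + w_j / 2], with product [w_i w_j / 2 + w_j ^ 2 / 4]. The integral of this expression is
    then transferred from the half to [V]. *)
Lemma integral_bisection i j V : i != j -> frame V ->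
  mu (simplex V) * \int[mu]_(y in simplex (bisection i j *m V))
      (bary V y 0%R i * bary V y 0%R j)%:E =
  mu (simplex (bisection i j *m V)) *
    ((2^-1)%:E * moment V i j + (4^-1)%:E * moment V j j).
Proof.
move=> ij fV; set W := bisection i j *m V; have fW := frame_bisection i j V ij fV.
pose f (a : 'rV[R]_(1 + d)) := (2^-1 * (a 0 i * a 0 j) + 4^-1 * (a 0 j * a 0 j))%R.
have mf : measurable_fun setT (EFin \o f).
  apply/measurable_EFinP.
  apply: measurable_funD; apply: measurable_funM => //; apply: measurable_funM;
    exact: (@measurable_mx_coord R 1).
have mi k l (c : R) :
    measurable_fun (simplex V) (fun y => (c * (bary V y 0 k * bary V y 0 l))%:E).
  apply: measurable_funTS; apply/measurable_EFinP; apply: measurable_funM => //.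
  by apply: measurable_funM; exact: measurable_bary_coord.
transitivity (mu (simplex V) * \int[mu]_(y in simplex W) (f (bary W y))%:E).
  congr (_ * _); apply: eq_integral => y _; congr EFin.
  rewrite /f !bary_bisection// !eqxx (eq_sym j i) (negbTE ij) /=.
  by field.
rewrite (simplex_integral_affine V W (EFin \o f))//; last first.
  by move=> a a0; rewrite lee_fin addr_ge0// mulr_ge0// ?mulr_ge0// invr_ge0.
congr (_ * _); rewrite /f /=.
have Vmeas := measurable_simplex V.
under eq_integral do rewrite EFinD.
rewrite ge0_integralD//; last 2 first.
- by move=> y Vy; rewrite lee_fin mulr_ge0// ?mulr_ge0// invr_ge0.
- by move=> y Vy; rewrite lee_fin mulr_ge0// ?mulr_ge0// invr_ge0.
have scal k l (c : R) : (0 <= c)%R ->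
    \int[mu]_(y in simplex V) (c * (bary V y 0 k * bary V y 0 l))%:E =
    c%:E * moment V k l.
  move=> c0; under eq_integral do rewrite EFinM.
  rewrite ge0_integralZl//.
    apply: measurable_funTS; apply/measurable_EFinP.
    by apply: measurable_funM; exact: measurable_bary_coord.
  by move=> y Vy; rewrite lee_fin mulr_ge0.
by rewrite !scal ?invr_ge0.
Qed.

Lemma simplex_bisectionU i j V : i != j -> frame V ->
  simplex V = simplex (bisection i j *m V) `|` simplex (bisection j i *m V).
Proof.
move=> ij fV; have ji : j != i by rewrite eq_sym.
rewrite !simplex_bisection// -setIUr.
apply/esym/setIidl => y _ /=.
by have [|/ltW] := leP (bary V y 0%R j) (bary V y 0%R i); [left|right].
Qed.

(** On the overlap coordinates [i] and [j] agree, an equation with coefficient vector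
    [invmx V *m e]. *)
Lemma simplex_bisection_null i j V : i != j -> frame V ->
  mu (simplex (bisection i j *m V) `&` simplex (bisection j i *m V)) = 0.
Proof.
move=> ij fV; pose e : 'cV[R]_(1 + d) := (delta_mx i 0 - delta_mx j 0)%R.
have e0 : e != 0%R.
  apply/eqP => /matrixP/(_ i 0%R); rewrite !mxE !eqxx (negbTE ij) subr0.
  by move/eqP; rewrite oner_eq0.
have c0 : invmx V *m e != 0%R.
  apply: contra e0 => /eqP /(congr1 (mulmx V)).
  by rewrite mulmxA mulmxV ?mulmx0 ?mul1mx; [move=> ->|exact: fV.1].
apply: (subset_measure0 _ _ _ (homog_hyperplane_null _ c0)) => //.
- by apply: measurableI; exact: measurable_simplex.
- exact: measurable_homog_hyperplane.
have ji : j != i by rewrite eq_sym.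
rewrite !simplex_bisection// => y [[_ /= leji] [_ /= leij]].
have -> : (homog y *m (invmx V *m e) = \col__ (bary V y 0 i - bary V y 0 j))%R.
  rewrite mulmxA -/(bary V y) mulmxBr -!colE.
  by apply/matrixP => k l; rewrite !mxE (ord1 k).
by rewrite mxE; apply/eqP; rewrite subr_eq0 eq_le leij leji.
Qed.

(** After multiplication by the volume of [V], each half contributes its own volume times
    [b / 2 + a / 4], and the two volumes add up to that of [V]. *)
Lemma moment_offdiag i j V : i != j -> frame V ->
  moment V i j = (2^-1)%:E * moment V j j.
Proof.
move=> ij fV; have [V0|V0] := eqVneq (mu (simplex V)) 0.
  by rewrite !moment_null// mule0.
have ji : j != i by rewrite eq_sym.
set W1 := bisection i j *m V; set W2 := bisection j i *m V.
have fW1 : frame W1 by exact: frame_bisection.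
have fW2 : frame W2 by exact: frame_bisection.
have finS W : frame W -> mu (simplex W) \is a fin_num.
  by move=> fW; rewrite ge0_fin_numE//; exact: simplex_finite_measure.
have splitI (f : 'rV[R]_d -> \bar R) : measurable_fun setT f ->
    (forall y, simplex V y -> 0 <= f y) -> \int[mu]_(y in simplex V) f y =
    \int[mu]_(y in simplex W1) f y + \int[mu]_(y in simplex W2) f y.
  move=> mf f0; have VU := simplex_bisectionU i j V ij fV.
  rewrite VU ge0_integral_setU_null//.
  - exact: measurable_simplex.
  - exact: measurable_simplex.
  - exact: measurable_funTS.
  - by rewrite -VU.
  - exact: simplex_bisection_null.
have mV : mu (simplex V) = mu (simplex W1) + mu (simplex W2).
  have := splitI (cst 1) (measurable_cst _) (fun _ _ => lee01).
  by rewrite !integral_cst ?mul1e//; exact: measurable_simplex.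
have := moment_fin_num V i j fV; have := moment_fin_num V j j fV.
suff : moment V i j = (2^-1)%:E * moment V i j + (4^-1)%:E * moment V j j.
  case: (moment V i j) (moment V j j) => [b| |] [a| |]//.
  by rewrite -!EFinM -EFinD => -[ba] _ _; congr EFin; lra.
apply: (mule_fin_inj _ _ _ V0); [exact: finS|exact: moment_fin_num| |].
  by rewrite fin_numD; apply/andP; split; apply: fin_numM => //; exact: moment_fin_num.
rewrite {1}/moment splitI; last 2 first.
- by apply/measurable_EFinP; apply: measurable_funM; exact: measurable_bary_coord.
- by move=> y Vy; rewrite lee_fin mulr_ge0.
rewrite ge0_muleDr; last 2 first.
- apply: integral_ge0 => y; rewrite simplex_bisection// => -[Vy _].
  by rewrite lee_fin mulr_ge0.
- apply: integral_ge0 => y; rewrite simplex_bisection// => -[Vy _].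
  by rewrite lee_fin mulr_ge0.
have mC : moment V j i = moment V i j.
  by apply: eq_integral => y _; rewrite mulrC.
have H1 := integral_bisection i j V ij fV.
have H2 := integral_bisection j i V ji fV.
(* In the second half [i] and [j] exchange roles; symmetry and equal diagonal moments give the same
   right-hand side as in the first. *)
rewrite mC (moment_diag_eq V i j)// in H2.
rewrite [in RHS]mV ge0_muleDl// -H1 -H2; congr (_ + _ * _).
by apply: eq_integral => y _; rewrite mulrC.
Qed.

(** The multiplicity [(i == j).+1] encodes the entries of [I + J]: 2 on the diagonal and 1
    elsewhere. *)
Lemma momentE V : frame V ->
  exists2 b : R, (0 <= b)%R & forall i j, moment V i j = (b *+ (i == j).+1)%:E.
Proof.
move=> fV; have fin0 := moment_fin_num V ord0 ord0 fV.
exists (2^-1 * fine (moment V ord0 ord0))%R.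
  by rewrite mulr_ge0 ?invr_ge0// fine_ge0// moment_ge0.
move=> i j; have [->|ij] := eqVneq i j.
  rewrite (moment_diag_eq V j ord0)// -[LHS]fineK//; congr EFin.
  by rewrite mulr2n; lra.
by rewrite moment_offdiag// (moment_diag_eq V j ord0)// EFinM fineK.
Qed.

End simplex_moments.

(** * Additivity over finitely many sets with null overlaps *)

Section integral_bigsetU_null.
Context d (T : measurableType d) (R : realType) (mu : {measure set T -> \bar R}).
Local Open Scope ereal_scope.

(** Measurability and sign on the union are carried through the induction, which applies the case of
    two sets to the first set and the union of the rest. *)
Lemma ge0_integral_bigsetU_null (I : eqType) (s : seq I) (D : I -> set T)
    (f : T -> \bar R) :
  uniq s -> (forall i, i \in s -> measurable (D i)) ->
  {in s &, forall i j, i != j -> mu.-negligible (D i `&` D j)} ->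
  (forall i, i \in s -> measurable_fun (D i) f) ->
  (forall i, i \in s -> forall x, D i x -> 0 <= f x) ->
  [/\ measurable (\big[setU/set0]_(i <- s) D i),
      measurable_fun (\big[setU/set0]_(i <- s) D i) f,
      forall x, (\big[setU/set0]_(i <- s) D i) x -> 0 <= f x &
  \int[mu]_(x in \big[setU/set0]_(i <- s) D i) f x =
    \sum_(i <- s) \int[mu]_(x in D i) f x].
Proof.
elim: s => [_ _ _ _ _|i s IH /= /andP[is_ us] mD D0 mf f0].
  rewrite !big_nil; split => //; first exact: measurable_fun_set0.
  exact: integral_set0.
have sub j : j \in s -> j \in i :: s by rewrite inE orbC => ->.
have [||||mU mfU fU0 intU] := IH us.
- by move=> j /sub; exact: mD.
- by move=> j k /sub js /sub ks; exact: D0.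
- by move=> j /sub; exact: mf.
- by move=> j /sub; exact: f0.
have mi : measurable (D i) by apply: mD; rewrite mem_head.
have fD0 : forall x, (D i `|` \big[setU/set0]_(j <- s) D j) x -> 0 <= f x.
  by move=> x [|/fU0//]; apply: f0; rewrite mem_head.
have mfD : measurable_fun (D i `|` \big[setU/set0]_(j <- s) D j) f.
  by apply/measurable_funU => //; split=> //; apply: mf; rewrite mem_head.
rewrite !big_cons; split => //; first exact: measurableU.
rewrite ge0_integral_setU_null// ?intU//.
apply: measure_negligible; first exact: measurableI.
rewrite setIC big_distrl/= big_seq.
apply: big_ind => [|A B|j js]; [exact: negligible_set0|exact: negligibleU|].
apply: D0; rewrite ?mem_head ?sub//.
by apply: contraNneq is_ => <-.
Qed.

End integral_bigsetU_null.

(** * Convex hulls of vertex sets: measurability, null sets, simplices *)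

Section hull.
Context {R : realType} {d : nat}.
Let mu := @lebesgue_measure_rV R d.

Definition vertex_mx (I : finType) (x : I -> 'rV[R]_d) m (k : 'I_m -> I) :
    'M[R]_(m, 1 + d) :=
  row_mx (const_mx 1) (\matrix_b x (k b)).
Arguments vertex_mx {I} x {m} k.

Variables (I : finType) (x : I -> 'rV[R]_d) (K : {set I}) (m : nat) (k : 'I_m -> I).
Hypotheses (k_inj : injective k) (kK : K = [set k a | a : 'I_m]).

Lemma row_vertex_mx a : row a (vertex_mx x k) = homog (x (k a)).
Proof.
rewrite row_row_mx rowK /homog; congr row_mx.
by apply/matrixP => i j; rewrite !mxE !ord1.
Qed.

Lemma big_vertices (T : nmodType) (F : I -> T) : \sum_(i in K) F i = \sum_a F (k a).
Proof. by rewrite kK big_imset//= => a b _ _; exact: k_inj. Qed.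

Lemma mul_vertex_mx (a : 'rV[R]_m) :
  a *m vertex_mx x k = row_mx (\sum_b a 0 b)%:M (\sum_b a 0 b *: x (k b)).
Proof.
rewrite mul_mx_row; congr row_mx.
  apply/matrixP => i j; rewrite !mxE !ord1 eqxx mulr1n.
  by apply: eq_bigr => b _; rewrite mxE mulr1.
by rewrite mulmx_sum_row; apply: eq_bigr => b _; rewrite rowK.
Qed.

(** Transports coefficients from positions to points; as [k] is injective, each sum has at most one
    term. *)
Let lift_coef (a : 'rV[R]_m) (i : I) := \sum_(b | k b == i) a 0 b.

Let lift_coefE a b : lift_coef a (k b) = a 0 b.
Proof.
by rewrite /lift_coef (eq_bigl (pred1 b)) ?big_pred1_eq// => c; rewrite (inj_eq k_inj).
Qed.

Lemma hullE : hull x K =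
  [set y | exists2 a : 'rV[R]_m, (forall i, 0 <= a 0 i) & a *m vertex_mx x k = homog y].
Proof.
apply/seteqP; split => y /=.
  move=> [c [c0 c1 ->]]; exists (\row_b c (k b)).
    by move=> b; rewrite mxE; apply: c0; rewrite kK; apply/imsetP; exists b.
  rewrite mul_vertex_mx /homog !big_vertices in c1 *; congr row_mx.
    by rewrite -c1; congr (_%:M); apply: eq_bigr => b _; rewrite mxE.
  by apply: eq_bigr => b _; rewrite mxE.
move=> [a a0]; rewrite mul_vertex_mx => /eq_row_mx[a1 ay].
exists (lift_coef a); split.
- by move=> i; rewrite kK => /imsetP[b _ ->]; rewrite lift_coefE.
- rewrite big_vertices; under eq_bigr do rewrite lift_coefE.
  by have /matrixP/(_ 0 0) := a1; rewrite !mxE !eqxx !mulr1n.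
- by rewrite big_vertices -ay; apply: eq_bigr => b _; rewrite lift_coefE.
Qed.

Lemma row_free_vertex_mx : affinely_independent x K -> row_free (vertex_mx x k).
Proof.
move=> aff; apply: inj_row_free => a; rewrite mul_vertex_mx => a0.
have /eq_row_mx[a1 ax] : row_mx (\sum_b a 0 b)%:M (\sum_b a 0 b *: x (k b)) =
  row_mx 0 0 :> 'rV_(1 + d) by rewrite a0 row_mx0.
apply/rowP => b; rewrite mxE -lift_coefE.
apply: (aff (lift_coef a)); rewrite ?big_vertices.
- under eq_bigr do rewrite lift_coefE.
  by have /matrixP/(_ 0 0) := a1; rewrite !mxE !eqxx !mulr1n.
- by under eq_bigr do rewrite lift_coefE.
- by rewrite kK; apply/imsetP; exists b.
Qed.

(** The rows are independent, so [p y] is the only possible coefficient vector of [y]: the hull is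
    the set where it is nonnegative and does reproduce [homog y]. That equation is written as two
    inequalities so that [measurable_nonneg_set] applies. *)
Lemma measurable_hull_vertices : affinely_independent x K -> measurable (hull x K).
Proof.
move=> /row_free_vertex_mx fM; rewrite hullE.
pose p y := homog y *m pinvmx (vertex_mx x k).
have mp : measurable_fun setT p.
  exact: (measurableT_comp (measurable_mulmxr _ _ _ _) measurable_homog).
rewrite (_ : mkset _ = [set y | forall i, 0 <= p y 0 i] `&`
   [set y | forall i, 0 <= (p y *m vertex_mx x k - homog y) 0 i] `&`
   [set y | forall i, 0 <= (- (p y *m vertex_mx x k - homog y)) 0 i]).
  have mq : measurable_fun setT (fun y => p y *m vertex_mx x k - homog y).
    apply: measurable_addmx.
      exact: (measurableT_comp (measurable_mulmxr _ _ _ _) mp).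
    exact: measurable_oppmx measurable_homog.
  apply: measurableI; [apply: measurableI|]; apply: measurable_nonneg_set => //.
  exact: measurable_oppmx.
apply/seteqP; split=> y /=.
  move=> [a a0 aE].
  have -> : p y = a by rewrite /p -aE mulmxKp.
  by rewrite aE subrr oppr0; split; [split|] => // i; rewrite mxE.
move=> [[p0 q0] q1]; exists (p y) => //.
apply/eqP; rewrite -subr_eq0; apply/eqP/rowP => i; rewrite [RHS]mxE.
apply/eqP; rewrite eq_le q0 andbT.
by have := q1 i; rewrite mxE oppr_ge0.
Qed.

(** With fewer rows than its [1 + d] columns, the vertex matrix has a nonzero cokernel, and a
    nonzero column of it is the equation of a hyperplane containing the hull. *)
Lemma hull_vertices_negligible : (m <= d)%N -> mu.-negligible (hull x K).
Proof.
move=> md; pose C := cokermx (vertex_mx x k).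
have [j Cj] : exists j, col j C != 0.
  apply/existsP; apply: contraT; rewrite negb_exists => /forallP C0.
  have : C = 0.
    apply/matrixP => a b; have := C0 b; rewrite negbK => /eqP/matrixP/(_ a 0).
    by rewrite !mxE.
  move/eqP; rewrite -mxrank_eq0 mxrank_coker subn_eq0.
  move=> /leq_trans/(_ (rank_leq_row _)).
  by rewrite leqNgt ltnS md.
exists [set y | (homog y *m col j C) 0 0 = 0]; split.
- exact: measurable_homog_hyperplane.
- exact: homog_hyperplane_null.
rewrite hullE => y [a _ aE] /=.
by rewrite -aE colE mulmxA -(mulmxA a) mulmx_coker mulmx0 mul0mx mxE.
Qed.

End hull.
Arguments vertex_mx {R d I} x {m} k.

Section hull_set.
Context {R : realType} {d : nat}.
Variables (I : finType) (x : I -> 'rV[R]_d) (K : {set I}).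
Let mu := @lebesgue_measure_rV R d.

Lemma enumerate_set m : #|K| = m ->
  exists2 k : 'I_m -> I, injective k & K = [set k a | a : 'I_m].
Proof.
move=> Km; exists (fun a => enum_val (cast_ord (esym Km) a)).
  by move=> a b /enum_val_inj /cast_ord_inj.
apply/setP => i; apply/idP/imsetP => [iK|[a _ ->]]; last exact: enum_valP.
exists (cast_ord Km (enum_rank_in iK i)) => //.
by rewrite cast_ordK enum_rankK_in.
Qed.

Lemma measurable_hull : affinely_independent x K -> measurable (hull x K).
Proof.
have [k ki kK] := enumerate_set _ erefl.
exact: (measurable_hull_vertices _ _ _ _ k ki kK).
Qed.

Lemma hull_negligible : (#|K| <= d)%N -> mu.-negligible (hull x K).
Proof.
have [k ki kK] := enumerate_set _ erefl.
exact: (hull_vertices_negligible _ x K _ k ki kK).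
Qed.

Lemma hull_simplex : #|K| = d.+1 -> affinely_independent x K ->
  exists (V : 'M[R]_(1 + d)) (k : 'I_(1 + d) -> I),
  [/\ frame V, injective k, K = [set k a | a : 'I_(1 + d)],
      forall a, row a V = homog (x (k a)) & hull x K = simplex V].
Proof.
move=> Kd aff; have [k ki kK] := enumerate_set (1 + d) Kd.
have uV : vertex_mx x k \in unitmx.
  by rewrite -row_free_unit; exact: (row_free_vertex_mx _ _ _ _ k ki kK).
exists (vertex_mx x k), k; split => //.
- by split => //; rewrite row_mxKl.
- by move=> a; rewrite row_vertex_mx.
- rewrite (hullE _ _ _ _ k ki kK); apply/seteqP; split => y /=.
    by move=> [a a0 aE] i; rewrite (bary_unique _ _ a).
  by move=> Vy; exists (bary (vertex_mx x k) y) => //; rewrite baryK.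
Qed.

End hull_set.

(** * Splitting an integral over the domain into the elements *)

Section mesh_integral.
Context {R : realType} {d : nat}.
Variables (Omega : set 'rV[R]_d) (N : nat) (x : 'I_N -> 'rV[R]_d).
Variable Th : {set {set 'I_N}}.
Let mu := @lebesgue_measure_rV R d.
Hypothesis mesh : simplicial_mesh Omega x Th.

(** Distinct vertex sets of equal size meet in a proper subset, so the common face has at most [d]
    vertices. *)
Lemma mesh_overlap_negligible K L : K \in Th -> L \in Th -> K != L ->
  mu.-negligible (hull x K `&` hull x L).
Proof.
move=> KT LT KL; rewrite (mesh_conforming mesh)//; apply: hull_negligible.
rewrite -ltnS -(mesh_card mesh KT); apply: proper_card.
rewrite properE subsetIl/=; apply: contra KL; rewrite finset.subsetI => /andP[_ KL].
by rewrite eqEcard KL (mesh_card mesh KT) (mesh_card mesh LT) leqnn.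
Qed.

Lemma measurable_element K : K \in Th -> measurable (hull x K).
Proof. by move=> KT; apply: measurable_hull; exact: (mesh_nondegenerate mesh). Qed.

Lemma bigcup_finset (I : finType) (F : {set I}) (D : I -> set 'rV[R]_d) :
  \bigcup_(i in [set` F]) D i = \big[setU/set0]_(i <- enum F) D i.
Proof.
by rewrite -bigcup_seq; apply: eq_bigcupl; split => i /=; rewrite mem_enum.
Qed.

(** The elements cover the closure, while the mass matrix integrates over [Omega]; a null boundary
    reconciles the two. *)
Lemma boundary_null : polyhedral_domain Omega ->
  measurable (boundary Omega) /\ mu (boundary Omega) = 0%E.
Proof.
move=> [_ _ _ _ [m [p [F [FP ->]]]]].
have mB : measurable (\bigcup_(f in [set` F]) hull p f).
  rewrite bigcup_finset big_seq; apply: bigsetU_measurable => f; rewrite mem_enum => fF.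
  by apply: measurable_hull; have [] := FP f fF.
split=> //; apply: measure_negligible => //; rewrite bigcup_finset big_seq.
apply: big_ind => [|A B|f]; [exact: negligible_set0|exact: negligibleU|].
by rewrite mem_enum => /FP[fd _]; apply: hull_negligible; rewrite fd.
Qed.

Lemma closure_boundary : open Omega -> Omega = closure Omega `\` boundary Omega.
Proof.
move=> /interior_id oO; rewrite /boundary oO setDD setIC; apply/esym/setIidl.
exact: subset_closure.
Qed.

Lemma integral_mesh (f : 'rV[R]_d -> \bar R) : polyhedral_domain Omega ->
  (forall K, K \in Th -> measurable_fun (hull x K) f) ->
  (forall K, K \in Th -> forall y, hull x K y -> 0 <= f y)%E ->
  (\int[mu]_(y in Omega) f y = \sum_(K in Th) \int[mu]_(y in hull x K) f y)%E.
Proof.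
move=> PO mf f0; have [mB B0] := boundary_null PO.
have oO : open Omega by case: PO.
have [|||||] := @ge0_integral_bigsetU_null _ _ _ mu _ (enum Th) (hull x) f.
- exact: enum_uniq.
- by move=> K; rewrite mem_enum; exact: measurable_element.
- by move=> K L; rewrite !mem_enum; exact: mesh_overlap_negligible.
- by move=> K; rewrite mem_enum; exact: mf.
- by move=> K; rewrite mem_enum; exact: f0.
rewrite -bigcup_finset (mesh_cover mesh) => mC mfC fC0; rewrite big_enum => <-.
by rewrite {1}closure_boundary// -ge0_negligible_integral.
Qed.

End mesh_integral.

(** * Hat functions on an element, local mass matrices and their assembly *)

Section hat_functions.
Context {R : realType} {d : nat}.
Variables (Omega : set 'rV[R]_d) (N : nat) (x : 'I_N -> 'rV[R]_d).
Variable Th : {set {set 'I_N}}.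
Let mu := @lebesgue_measure_rV R d.
Hypothesis mesh : simplicial_mesh Omega x Th.

(** An affine function is linear in [homog y], so it is the barycentric combination of its vertex
    values, here 0 or 1. *)
Lemma hat_function_bary j f K V (k : 'I_(1 + d) -> 'I_N) :
  hat_function Omega x Th j f -> K \in Th ->
  frame V -> hull x K = simplex V -> (forall a, row a V = homog (x (k a))) ->
  forall y, hull x K y -> f y = \sum_a bary V y 0 a * (k a == j)%:R.
Proof.
move=> [_ aff fx] KT fV KV rV y Ky; have [c [b fE]] := aff K KT.
have fhE z : hull x K z -> f z = (homog z *m col_mx b%:M c) 0 0.
  move=> Kz; rewrite fE// addrC mul_row_col mul1mx [RHS]mxE.
  by rewrite [X in _ = X + _]mxE eqxx mulr1n.
have xK a : hull x K (x (k a)).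
  rewrite KV => i; rewrite (bary_unique _ _ (delta_mx 0 a)) ?mxE//; first exact: fV.1.
  by rewrite -rowE.
rewrite fhE// -(baryK V y fV.1) -mulmxA mxE; apply: eq_bigr => a _; congr (_ * _).
by rewrite -fx fhE// -rV -row_mul [RHS]mxE.
Qed.

(** On [K] a hat function is the barycentric coordinate of its vertex, or zero if that vertex is not
    in [K]. The constant [b] is chosen before the vertices, so one number describes the whole local
    matrix. *)
Lemma element_mass K : K \in Th -> exists2 b : R, 0 <= b & forall i j f g,
  hat_function Omega x Th i f -> hat_function Omega x Th j g ->
  [/\ measurable_fun (hull x K) (fun y => (f y * g y)%:E),
      forall y, hull x K y -> 0 <= f y * g y &
  (\int[mu]_(y in hull x K) (f y * g y)%:E =
    (b *+ [&& i \in K & j \in K] *+ (i == j).+1)%:E)%E].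
Proof.
move=> KT.
have [V [k [fV ki kK rV KV]]] :=
  hull_simplex _ x K (mesh_card mesh KT) (mesh_nondegenerate mesh KT).
have [b b0 bE] := momentE V fV.
exists b => // i j f g hf hg.
pose h l y := \sum_a bary V y 0 a * (k a == l)%:R.
have fgE y : hull x K y -> f y * g y = h i y * h j y.
  by move=> Ky; rewrite (hat_function_bary _ _ _ _ _ hf KT fV KV rV y Ky)
    (hat_function_bary _ _ _ _ _ hg KT fV KV rV y Ky).
have mh l : measurable_fun setT (h l).
  apply: measurable_sum => a; apply: measurable_funM => //.
  exact: measurable_bary_coord.
have h0 l y : hull x K y -> 0 <= h l y.
  by rewrite KV => Vy; apply: sumr_ge0 => a _; rewrite mulr_ge0.
have hk a y : h (k a) y = bary V y 0 a.
  rewrite /h (bigD1 a)//= eqxx mulr1 big1 ?addr0// => c ca.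
  by rewrite (inj_eq ki) (negbTE ca) mulr0.
have hN l y : l \notin K -> h l y = 0.
  move=> lK; apply: big1 => a _; case: eqP => [kal|]; last by rewrite mulr0.
  by move: lK; rewrite -kal kK imset_f.
have mhh : measurable_fun (hull x K) (fun y => (h i y * h j y)%:E).
  by apply: measurable_funTS; apply/measurable_EFinP; exact: measurable_funM.
split.
- apply: (eq_measurable_fun (fun y => (h i y * h j y)%:E)) => // y.
  by rewrite inE => Ky; rewrite fgE.
- by move=> y Ky; rewrite fgE// mulr_ge0// h0.
transitivity (\int[mu]_(y in hull x K) (h i y * h j y)%:E)%E.
  by apply: eq_integral => y; rewrite inE => Ky; rewrite fgE.
have [iK|iK] := boolP (i \in K); last first.
  rewrite mulr0n mul0rn; apply: integral0_eq => y Ky.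
  by rewrite hN// mul0r.
have [jK|jK] := boolP (j \in K); last first.
  rewrite mulr0n mul0rn; apply: integral0_eq => y Ky.
  by rewrite [h j y]hN// mulr0.
have /imsetP[a _ ia] := eq_ind _ (fun A : {set 'I_N} => i \in A) iK _ kK.
have /imsetP[c _ jc] := eq_ind _ (fun A : {set 'I_N} => j \in A) jK _ kK.
rewrite ia jc (inj_eq ki) mulr1n -bE /moment -KV; apply: eq_integral => y _.
by rewrite !hk.
Qed.

End hat_functions.

Lemma mass_matrixE {R : realType} {d : nat} (Omega : set 'rV[R]_d) Nvi Nvb
    (x : 'I_(Nvi + Nvb) -> 'rV[R]_d) (Th : {set {set 'I_(Nvi + Nvb)}})
    (phi : 'I_Nvi -> 'rV[R]_d -> R) :
  polyhedral_domain Omega -> simplicial_mesh Omega x Th ->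
  (forall j, hat_function Omega x Th (lshift Nvb j) (phi j)) ->
  exists2 b : {set 'I_(Nvi + Nvb)} -> R, (forall K, 0 <= b K) &
  forall i j, mass_matrix Omega phi i j =
    \sum_(K in Th) b K *+ [&& lshift Nvb i \in K & lshift Nvb j \in K] *+ (i == j).+1.
Proof.
move=> PO mesh hphi.
pose P (K : {set 'I_(Nvi + Nvb)}) (b : R) := 0 <= b /\ (K \in Th -> forall i j f g,
  hat_function Omega x Th i f -> hat_function Omega x Th j g ->
  [/\ measurable_fun (hull x K) (fun y => (f y * g y)%:E),
      forall y, hull x K y -> 0 <= f y * g y &
  (\int[lebesgue_measure_rV d]_(y in hull x K) (f y * g y)%:E =
    (b *+ [&& i \in K & j \in K] *+ (i == j).+1)%:E)%E]).
(* Sets outside [Th] receive the constant 0, which keeps [b] total and nonnegative. *)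
have /boolp.choice[b bP] : forall K, exists b, P K b.
  move=> K; have [KT|KT] := boolP (K \in Th).
    by have [b b0 bE] := element_mass Omega _ x Th mesh K KT; exists b.
  by exists 0; split=> // KT'; rewrite KT' in KT.
exists b => [K|i j]; first by have [] := bP K.
rewrite mxE /Rintegral (integral_mesh Omega _ x Th mesh)//; last 2 first.
- by move=> K KT; have [_ /(_ KT _ _ _ _ (hphi i) (hphi j))[]] := bP K.
- move=> K KT y Ky; have [_ /(_ KT _ _ _ _ (hphi i) (hphi j))[_ + _]] := bP K.
  by move=> /(_ y Ky); rewrite lee_fin.
rewrite (eq_bigr (fun K =>
    (b K *+ [&& lshift Nvb i \in K & lshift Nvb j \in K] *+ (i == j).+1)%:E)).
  by rewrite sumEFin.
move=> K KT; have [_ /(_ KT _ _ _ _ (hphi i) (hphi j))[_ _ ->]] := bP K.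
by rewrite (inj_eq (@lshift_inj _ _)).
Qed.

(** * Quadratic forms of symmetric matrices *)

Section quadratic_form.
Context {R : realType} {n : nat}.
Implicit Types (B C : 'M[R]_n) (u v w : 'rV[R]_n).

Definition qform B u : R := (u *m B *m u^T) 0 0.

Lemma qformE B u : qform B u = \sum_i \sum_j u 0 i * B i j * u 0 j.
Proof.
rewrite /qform mxE exchange_big; apply: eq_bigr => j _.
by rewrite !mxE mulr_suml.
Qed.

Lemma qform1 u : qform 1%:M u = \sum_i u 0 i ^+ 2.
Proof. by rewrite /qform mulmx1 mxE; apply: eq_bigr => i _; rewrite mxE expr2. Qed.

Lemma qform1_ge0 u : 0 <= qform 1%:M u.
Proof. by rewrite qform1 sumr_ge0// => i _; exact: sqr_ge0. Qed.

Lemma qform1_eq0 u : (qform 1%:M u == 0) = (u == 0).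
Proof.
apply/eqP/eqP => [|->]; last by rewrite /qform !mul0mx mxE.
rewrite qform1 => /eqP; rewrite psumr_eq0 => [/allP u0|i _]; last exact: sqr_ge0.
by apply/rowP => i; have := u0 i (mem_index_enum i); rewrite sqrf_eq0 mxE => /eqP.
Qed.

Lemma qform1_gt0 u : u != 0 -> 0 < qform 1%:M u.
Proof. by move=> u0; rewrite lt_def qform1_eq0 u0 qform1_ge0. Qed.

Lemma qformZ B a u : qform B (a *: u) = a ^+ 2 * qform B u.
Proof. by rewrite /qform linearZ/= -!scalemxAl -!scalemxAr !mxE mulrA expr2. Qed.

Lemma qformN B u : qform (- B) u = - qform B u.
Proof. by rewrite /qform mulmxN mulNmx mxE. Qed.

Lemma qform_delta B i : qform B (delta_mx 0 i) = B i i.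
Proof. by rewrite /qform -rowE trmx_delta -colE !mxE. Qed.

Lemma qformD B u w t : B^T = B ->
  qform B (u + t *: w) =
  qform B u + 2 * t * (u *m B *m w^T) 0 0 + t ^+ 2 * qform B w.
Proof.
move=> Bs.
have bE : (w *m B *m u^T) 0 0 = (u *m B *m w^T) 0 0.
  transitivity ((w *m B *m u^T)^T 0 0); first by rewrite [RHS]mxE.
  by rewrite !trmx_mul trmxK Bs mulmxA.
rewrite /qform linearD linearZ/= !mulmxDl !mulmxDr -!scalemxAl -!scalemxAr.
have addE (a b : 'M[R]_1) : (a + b) 0 0 = a 0 0 + b 0 0 by rewrite mxE.
have scaleE c (a : 'M[R]_1) : (c *: a) 0 0 = c * a 0 0 by rewrite mxE.
by rewrite !addE !scaleE bE; ring.
Qed.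

Lemma continuous_qform B : continuous (qform B).
Proof.
have -> : qform B = fun u => \sum_i \sum_j u 0 i * B i j * u 0 j.
  by apply/funext => u; rewrite qformE.
have co i : continuous (fun u => u 0 i) by exact: coord_continuous.
apply: (@continuous_big _ _ +%R 0 xpredT add_continuous) => i _.
apply: (@continuous_big _ _ +%R 0 xpredT add_continuous) => j _ u.
apply: (@cvgM _ _ (nbhs u)); last exact: co.
by apply: (@cvgM _ _ (nbhs u)); [exact: co|exact: cvg_cst].
Qed.

(** A nonnegative form that vanishes at [v] is minimal there, so its gradient, a multiple of
    [v *m C], vanishes too. *)
Lemma psd_kernel C v : C^T = C -> (forall w, 0 <= qform C w) -> qform C v = 0 ->
  v *m C = 0.
Proof.
move=> Cs C0 v0; apply/eqP; rewrite -qform1_eq0.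
(* [qform C (v + t *: w)] has no constant term in [t], and linear term [2 t a]. *)
set w := v *m C; set a := qform _ w; set c := qform C w.
have aE : (v *m C *m w^T) 0 0 = a by rewrite /a /qform mulmx1.
have a0 : 0 <= a by exact: qform1_ge0.
have c0 : 0 <= c by exact: C0.
have c1 : 0 < c + 1 by rewrite ltr_wpDl.
(* This [t] makes the form equal to [- a ^ 2 (c + 2) / (c + 1) ^ 2], so nonnegativity forces
   [a = 0]. The denominator is [c + 1] because [c] may be 0. *)
have := C0 (v + (- (a / (c + 1))) *: w).
rewrite qformD// v0 aE -/c add0r.
have -> : 2 * - (a / (c + 1)) * a + (- (a / (c + 1))) ^+ 2 * c =
   - (a ^+ 2 * ((c + 2) / (c + 1) ^+ 2)).
  by field; rewrite gt_eqF.
rewrite oppr_ge0 pmulr_lle0 ?divr_gt0 ?exprn_gt0 ?ltr_wpDl//.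
by rewrite le_eqVlt ltNge sqr_ge0 orbF sqrf_eq0.
Qed.

End quadratic_form.

(** * Extreme eigenvalues as extrema of the Rayleigh quotient *)

Section rayleigh.
Context {R : realType} {n : nat}.
Implicit Types (B : 'M[R]_n.+1) (u v w : 'rV[R]_n.+1).

(** The matrix norm is the largest absolute entry, which is at most 1 when the squares sum to 1. *)
Lemma sphere_compact : compact [set u : 'rV[R]_n.+1 | qform 1%:M u = 1].
Proof.
apply: bounded_closed_compact; last first.
  apply: (@preimage_closed _ _ (qform 1%:M) [set 1]); last exact: closed_eq.
  by move=> u _; exact: continuous_qform.
exists 1; split; first exact: num_real.
move=> M M1 u /= u1; rewrite (le_trans _ (ltW M1))//.
rewrite [leLHS]/Num.norm/= mx_normrE; apply/bigmax_leP; split => // -[i j] _ /=.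
rewrite -(@ler_pXn2r _ 2)// ?nnegrE// expr1n real_normK ?num_real// (ord1 i) -u1 qform1.
by rewrite (bigD1 j)//= lerDl sumr_ge0// => k _; exact: sqr_ge0.
Qed.

(** Let [M] be the maximum of the form on the unit sphere, attained at [v]. The form of [M I - B] is
    nonnegative and vanishes at [v], so [psd_kernel] makes [v] an eigenvector for [M]. *)
Lemma rayleigh_max B : B^T = B ->
  exists M, eigenvalue B M /\ forall w, qform B w <= M * qform 1%:M w.
Proof.
move=> Bs; have S0 : [set u : 'rV[R]_n.+1 | qform 1%:M u = 1] !=set0.
  by exists (delta_mx 0 0); rewrite /= qform_delta mxE eqxx.
have [|v vS vmax] := compact_EVT_max S0 sphere_compact (f := qform B).
  exact/continuous_subspaceT/continuous_qform.
have v1 : qform 1%:M v = 1 by move: vS; rewrite inE.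
exists (qform B v).
have vP w : qform B w <= qform B v * qform 1%:M w.
  have [->|w0] := eqVneq w 0.
    by rewrite /qform !mul0mx mxE mulr0.
  have w1 := qform1_gt0 _ w0; pose a := (Num.sqrt (qform 1%:M w))^-1.
  have aE : a ^+ 2 = (qform 1%:M w)^-1 by rewrite /a exprVn sqr_sqrtr// ltW.
  have := vmax (a *: w); rewrite inE/= !qformZ aE mulVf ?gt_eqF// => /(_ erefl).
  by rewrite mulrC ler_pdivrMr.
split => //; apply/eigenvalueP; exists v; last first.
  by rewrite -qform1_eq0 v1 oner_eq0.
pose C := (qform B v)%:M - B.
have CE w : qform C w = qform B v * qform 1%:M w - qform B w.
  by rewrite /C /qform mulmxBr mulmxBl mul_mx_scalar -scalemxAl mulmx1 !mxE.
apply/esym/eqP; rewrite -subr_eq0 -mul_mx_scalar -mulmxBr; apply/eqP.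
apply: psd_kernel.
- by rewrite linearB/= tr_scalar_mx Bs.
- by move=> w; rewrite CE subr_ge0.
- by rewrite CE v1 mulr1 subrr.
Qed.

Lemma eigenvalue_qform B a : eigenvalue B a ->
  exists2 v, v != 0 & qform B v = a * qform 1%:M v.
Proof.
move=> /eigenvalueP[v vB v0]; exists v => //.
by rewrite /qform vB mulmx1 -scalemxAl mxE.
Qed.

Lemma lambda_maxP B : B^T = B ->
  eigenvalue B (lambda_max B) /\ forall w, qform B w <= lambda_max B * qform 1%:M w.
Proof.
move=> /rayleigh_max[M [eM MP]]; suff -> : lambda_max B = M by [].
have ubM : ubound [set a | eigenvalue B a] M.
  move=> a /= /eigenvalue_qform[v v0 vE].
  by have := MP v; rewrite vE ler_pM2r// qform1_gt0.
apply/eqP; rewrite eq_le ge_sup//=; last by exists M.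
by apply: ub_le_sup => //; exists M.
Qed.

Lemma lambda_minN B : lambda_min B = - lambda_max (- B).
Proof.
rewrite /lambda_min /lambda_max /inf; congr (- sup _).
apply/seteqP; split => a /=.
  move=> [b /eigenvalueP[v vB v0] <-]; apply/eigenvalueP; exists v => //.
  by rewrite mulmxN vB scaleNr.
move=> /eigenvalueP[v vB v0]; exists (- a); last by rewrite opprK.
by apply/eigenvalueP; exists v => //; rewrite -[B]opprK mulmxN vB scaleNr.
Qed.

Lemma lambda_minP B : B^T = B ->
  eigenvalue B (lambda_min B) /\ forall w, lambda_min B * qform 1%:M w <= qform B w.
Proof.
move=> Bs; have [|/eigenvalueP[v vB v0] NP] := lambda_maxP (- B).
  by rewrite linearN/= Bs.
rewrite lambda_minN; split.
  by apply/eigenvalueP; exists v => //; rewrite -[B]opprK mulmxN vB scaleNr opprK.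
by move=> w; have := NP w; rewrite qformN mulNr lerNl.
Qed.

End rayleigh.

(** * Condition number and diagonal entries *)

Section diagonal.
Context {R : realType} {n : nat}.
Implicit Types B : 'M[R]_n.+1.

Lemma max_diag_ge B j : B j j <= max_diag B.
Proof.
apply: ub_le_sup; last by exists j.
exists (\sum_i `|B i i|) => _ [i _ <-].
rewrite (bigD1 i)//= (le_trans (ler_norm _))// lerDl.
by apply: sumr_ge0.
Qed.

Lemma max_diag_le B M : (forall j, B j j <= M) -> max_diag B <= M.
Proof.
by move=> BM; apply: ge_sup => [|_ [j _ <-]//]; exists (B 0 0); exists 0.
Qed.

Lemma min_diag_le B j : min_diag B <= B j j.
Proof.
apply: ge_inf; last by exists j.
exists (- \sum_i `|B i i|) => _ [i _ <-].
rewrite lerNl (bigD1 i)//= (@le_trans _ _ `|B i i|) ?lerDl ?sumr_ge0//.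
by rewrite -normrN ler_norm.
Qed.

Lemma min_diag_ge B M : (forall j, M <= B j j) -> M <= min_diag B.
Proof.
by move=> BM; apply: lb_le_inf => [|_ [j _ <-]//]; exists (B 0 0); exists 0.
Qed.

(** Diagonal entries are values of the form at unit vectors, so they lie between the extreme
    eigenvalues. Conversely, the two comparisons with the diagonal form, taken at extreme
    eigenvectors, bound these eigenvalues by diagonal entries. *)
Lemma condition_number_bounds B (c e : R) : B^T = B -> 0 < c -> 0 <= e ->
  (forall j, 0 <= B j j) ->
  (forall u : 'rV_n.+1, c * \sum_i u 0 i ^+ 2 * B i i <= qform B u) ->
  (forall u : 'rV_n.+1, qform B u <= e * \sum_i u 0 i ^+ 2 * B i i) ->
  max_diag B / min_diag B <= condition_number B /\
  condition_number B <= e / c * (max_diag B / min_diag B).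
Proof.
move=> Bs c0 e0 B0 lowB upB.
have [emax maxP] := lambda_maxP B Bs; have [emin minP] := lambda_minP B Bs.
have delta1 (j : 'I_n.+1) : qform 1%:M (delta_mx 0 j : 'rV[R]_n.+1) = 1.
  by rewrite qform_delta mxE eqxx.
have maxL : max_diag B <= lambda_max B.
  apply: max_diag_le => j; have := maxP (delta_mx 0 j).
  by rewrite delta1 qform_delta mulr1.
have minL : lambda_min B <= min_diag B.
  apply: min_diag_ge => j; have := minP (delta_mx 0 j).
  by rewrite delta1 qform_delta mulr1.
have maxU : lambda_max B <= e * max_diag B.
  have [v v0 vE] := eigenvalue_qform B _ emax; have v1 := qform1_gt0 v v0.
  rewrite -(ler_pM2r v1) -vE (le_trans (upB v))// -mulrA ler_wpM2l//.
  rewrite qform1 mulr_sumr; apply: ler_sum => i _.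
  by rewrite mulrC ler_wpM2r ?sqr_ge0// max_diag_ge.
have minU : c * min_diag B <= lambda_min B.
  have [v v0 vE] := eigenvalue_qform B _ emin; have v1 := qform1_gt0 v v0.
  rewrite -(ler_pM2r v1) -vE (le_trans _ (lowB v))// -mulrA ler_pM2l//.
  rewrite qform1 mulr_sumr; apply: ler_sum => i _.
  by rewrite [leRHS]mulrC ler_wpM2r ?sqr_ge0// min_diag_le.
have max0 : 0 <= max_diag B by rewrite (le_trans (B0 0))// max_diag_ge.
have : 0 <= min_diag B by exact: min_diag_ge.
rewrite /condition_number le_eqVlt => /predU1P[min0|min_gt0].
  (* Then [lambda_min B = 0], and all quotients are 0 since [x / 0 = 0]. *)
  have -> : lambda_min B = 0.
    by apply/eqP; rewrite eq_le {1}min0 minL (le_trans _ minU)// -min0 mulr0.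
  by rewrite -min0 invr0 !mulr0.
have l_gt0 : 0 < lambda_min B by rewrite (lt_le_trans _ minU)// mulr_gt0.
split.
  apply: ler_pM => //; first by rewrite invr_ge0 ltW.
  by rewrite lef_pV2.
have -> : e / c * (max_diag B / min_diag B) = (e * max_diag B) / (c * min_diag B).
  by field; rewrite !gt_eqF.
apply: ler_pM => //; first exact: le_trans maxL.
  by rewrite invr_ge0 ltW.
by rewrite lef_pV2// posrE mulr_gt0.
Qed.

End diagonal.

(** * Comparing a sum of local matrices with its diagonal *)

Section element_sums.
Context {R : realType} {n : nat} {E : finType}.
Variables (A : E -> {set 'I_n}) (Th : {set E}) (b : E -> R) (B : 'M[R]_n).
Hypothesis b0 : forall K, 0 <= b K.
Hypothesis BE : forall i j,
  B i j = \sum_(K in Th) b K *+ [&& i \in A K & j \in A K] *+ (i == j).+1.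

(** In the form of [I + J], the part [J] gives the squared sum and [I] the sum of squares. *)
Lemma sum_of_elements_qform (u : 'rV_n) : qform B u =
  \sum_(K in Th) b K * ((\sum_(i in A K) u 0 i) ^+ 2 + \sum_(i in A K) u 0 i ^+ 2).
Proof.
rewrite qformE.
transitivity (\sum_(K in Th) \sum_i \sum_j
    u 0 i * (b K *+ [&& i \in A K & j \in A K] *+ (i == j).+1) * u 0 j).
  rewrite [RHS]exchange_big; apply: eq_bigr => i _ /=.
  rewrite [RHS]exchange_big; apply: eq_bigr => j _ /=.
  by rewrite BE mulr_sumr mulr_suml.
apply: eq_bigr => K _; rewrite expr2 mulr_suml -big_split mulr_sumr.
rewrite [RHS]big_mkcond; apply: eq_bigr => i _ /=.
case: ifP => iK; last first.
  by apply: big1 => j _; rewrite mulr0n mul0rn mulr0 mul0r.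
rewrite mulrDr mulr_sumr [in RHS]big_mkcond.
(* The multiplicity [(i == j).+1] is split into 1 for every pair and one more on the diagonal. *)
transitivity (\sum_j ((if j \in A K then b K * (u 0 i * u 0 j) else 0) +
    (if j == i then b K * u 0 i ^+ 2 else 0))).
  apply: eq_bigr => j _ /=; rewrite (eq_sym j i).
  have [<-|ij] := eqVneq i j.
    by rewrite iK mulr1n mulr2n; ring.
  case: ifP => jK; first by rewrite /= !mulr1n addr0; ring.
  by rewrite mulr0n mul0rn mulr0 mul0r addr0.
rewrite big_split/= -big_mkcond -mulr_sumr; congr (_ + _).
  by rewrite -[in RHS]big_mkcond.
by rewrite -big_mkcond big_pred1_eq.
Qed.

Lemma sum_of_elements_diag (u : 'rV_n) : \sum_i u 0 i ^+ 2 * B i i =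
  \sum_(K in Th) b K * (2 * \sum_(i in A K) u 0 i ^+ 2).
Proof.
under eq_bigr do rewrite BE mulr_sumr.
rewrite exchange_big; apply: eq_bigr => K _ /=.
rewrite mulrA [in RHS]big_mkcond mulr_sumr; apply: eq_bigr => i _.
rewrite eqxx andbb mulr2n; case: ifP => _; rewrite ?mulr1n ?mulr0n ?addr0 ?mulr0//.
by ring.
Qed.

(** The Cauchy-Schwarz inequality: the sum of all [(f i - f j) ^ 2] is twice the right side minus
    twice the left side. *)
Lemma sqr_sum_le (S : {set 'I_n}) (f : 'I_n -> R) :
  (\sum_(i in S) f i) ^+ 2 <= #|S|%:R * \sum_(i in S) f i ^+ 2.
Proof.
have : 0 <= \sum_(i in S) \sum_(j in S) (f i - f j) ^+ 2.
  by apply: sumr_ge0 => i _; apply: sumr_ge0 => j _; exact: sqr_ge0.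
have -> : \sum_(i in S) \sum_(j in S) (f i - f j) ^+ 2 =
    \sum_(i in S) (f i ^+ 2 *+ #|S| - f i * (\sum_(j in S) f j) *+ 2 +
                    \sum_(j in S) f j ^+ 2).
  apply: eq_bigr => i _; rewrite -sumr_const mulr_sumr -sumrMnl -sumrB -big_split/=.
  by apply: eq_bigr => j _; rewrite sqrrB.
rewrite big_split sumrB/= !sumrMnl -mulr_suml sumr_const -expr2.
rewrite -mulr_natl; set s := \sum_(i in S) f i; set q := \sum_(i in S) f i ^+ 2.
by rewrite -[q *+ _]mulr_natl; lra.
Qed.

(** Dropping the squared sum leaves half of the diagonal form on each element. *)
Lemma sum_of_elements_lower (u : 'rV_n) : 2^-1 * \sum_i u 0 i ^+ 2 * B i i <= qform B u.
Proof.
rewrite sum_of_elements_diag sum_of_elements_qform mulr_sumr; apply: ler_sum => K _.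
by rewrite mulrCA ler_wpM2l// mulKf// lerDr sqr_ge0.
Qed.

(** The squared sum is at most [m] times the sum of squares, giving [m + 1] copies of it against 2
    in the diagonal form. *)
Lemma sum_of_elements_upper m (u : 'rV_n) : (forall K, K \in Th -> (#|A K| <= m)%N) ->
  qform B u <= m.+1%:R / 2 * \sum_i u 0 i ^+ 2 * B i i.
Proof.
move=> Am; rewrite sum_of_elements_diag sum_of_elements_qform mulr_sumr.
apply: ler_sum => K KT; rewrite mulrCA ler_wpM2l// mulrA divfK//.
rewrite -(addn1 m) natrD mulrDl mul1r lerD2r (le_trans (sqr_sum_le _ _))//.
rewrite ler_wpM2r ?ler_nat ?Am// sumr_ge0// => i _; exact: sqr_ge0.
Qed.

End element_sums.

Theorem theorem3p1 (R : realType) (d : nat) (Omega : set 'rV[R]_d)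
    (Nvi Nvb : nat) (x : 'I_(Nvi + Nvb) -> 'rV[R]_d)
    (Th : {set {set 'I_(Nvi + Nvb)}}) (phi : 'I_Nvi -> 'rV[R]_d -> R) :
  (1 <= d)%N ->
  polyhedral_domain Omega ->
  @simply_connected R _ Omega ->
  simplicial_mesh Omega x Th ->
  (0 < Nvi)%N ->
  interior_first Omega x ->
  (forall j : 'I_Nvi, hat_function Omega x Th (lshift Nvb j) (phi j)) ->
  let B := mass_matrix Omega phi in
  max_diag B / min_diag B <= condition_number B /\
  condition_number B <= (d + 2)%:R * (max_diag B / min_diag B).
Proof.
case: Nvi x Th phi => [|n] x Th phi; first by move=> _ _ _ _ [].
move=> _ PO _ mesh _ _ hphi B.
have [b b0 BE] := mass_matrixE Omega _ _ x Th phi PO mesh hphi.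
(* Only interior vertices index [B], so [A K] may have fewer than [d + 1] elements near the
   boundary; an upper bound on its size suffices. *)
pose A (K : {set 'I_(n.+1 + Nvb)}) := [set i : 'I_n.+1 | lshift Nvb i \in K]%SET.
have BE' i j : B i j = \sum_(K in Th) b K *+ [&& i \in A K & j \in A K] *+ (i == j).+1.
  by rewrite BE; apply: eq_bigr => K _; rewrite !finset.inE.
have AK K : K \in Th -> (#|A K| <= d.+1)%N.
  move=> KT; rewrite -(mesh_card mesh KT) -(card_imset _ (@lshift_inj n.+1 Nvb)).
  by apply/subset_leq_card/fintype.subsetP => _ /imsetP[i + ->]; rewrite finset.inE.
have low := sum_of_elements_lower A Th b B b0 BE'.
have up u := sum_of_elements_upper A Th b B b0 BE' d.+1 u AK.
have Bs : B^T = B.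
  apply/matrixP => i j; rewrite mxE !BE'; apply: eq_bigr => K _.
  by rewrite andbC eq_sym.
have B0 j : 0 <= B j j.
  by rewrite BE'; apply: sumr_ge0 => K _; rewrite !mulrn_wge0.
(* The constant is the quotient of the upper factor [(d + 2) / 2] by the lower factor [1 / 2]. *)
have -> : (d + 2)%:R = (d.+2%:R / 2) / 2^-1 :> R by rewrite invrK divfK// addn2.
by apply: condition_number_bounds => //; rewrite ?invr_gt0// divr_ge0.
Qed.
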